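(* Let $X$ be a unit Killing vector field on a Riemannian manifold $(M,g)$ which generates a one-parameter group $\gamma(s)$, $s\in\mathbb{R}$, of motions of $M$. Let $x\in M$, $w\in M_x$, and let $Y(s)=d(\gamma(s))(w)$, $s\in\mathbb{R}$, be the corresponding vector field along the curve $c(s)=\gamma(s)(x)$. Then, along $c$, $$g(Y,Y)\equiv g(w,w),\qquad g(Y,X)\equiv g(w,X(x)),$$ $$g(\nabla_XY,\nabla_XY)=g(R(X,Y)Y,X)=\mathrm{const}.$$ In particular, if $g(w,w)=1$ and $w\perp X(x)$, then $$g(\nabla_XY,\nabla_XY)=K(X,Y)=\mathrm{const}.$$
   Context: A Riemannian manifold means a connected complete $C^\infty$-smooth Riemannian manifold. $M_x$ is the tangent space at $x$. A Killing vector field is a smooth vector field $X$ with $L_Xg=0$; unit means $g(X,X)\equiv1$. $\nabla$ is the Levi-Civita connection; $\nabla_XY$ denotes the covariant derivative of $Y$ along $c$ (whose velocity is $X$). $R$ is the curvature tensor with the sign convention that $g(R(U,V)V,U)=K(U,V)$ is the sectional curvature for orthonormal $U,V$. *)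

(* Defs.v *)
From mathcomp Require Import all_boot all_order all_algebra.
From mathcomp Require Import all_classical all_reals all_analysis.

Set Implicit Arguments.
Unset Strict Implicit.
Unset Printing Implicit Defensive.

Import Order.TTheory GRing.Theory Num.Theory.
Import numFieldNormedType.Exports.

Local Open Scope classical_set_scope.
Local Open Scope ring_scope.

(* [Ck_on k U f] is meant for finite-dimensional [E] and open [U]: f is C^(k+1)
   iff it is differentiable and all its directional derivatives are C^k. *)
Fixpoint Ck_on (R : realType) (E V : normedModType R) (k : nat) (U : set E)
    (f : E -> V) : Prop :=
  match k with
  | 0 => forall x, U x -> {for x, continuous f}
  | k'.+1 => (forall x, U x -> differentiable f x) /\
             (forall v : E, Ck_on k' U (fun x => 'D_v f x))
  end.

Definition smooth_on (R : realType) (E V : normedModType R) (U : set E)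
    (f : E -> V) : Prop :=
  forall k, Ck_on k U f.

(* [cinv] is total; only its values on [cimg] are meaningful. *)
Record chart (R : realType) (n : nat) (M : topologicalType) := Chart {
  cdom : set M;
  cfun : M -> 'rV[R]_n;
  cinv : 'rV[R]_n -> M;
  cdom_open : open cdom;
  cimg_open : open (cfun @` cdom);
  cfunK : forall p, cdom p -> cinv (cfun p) = p;
  cfun_continuous : forall p, cdom p -> {for p, continuous cfun};
  cinv_continuous : forall y, (cfun @` cdom) y -> {for y, continuous cinv}
}.

Definition cimg (R : realType) (n : nat) (M : topologicalType)
    (phi : chart R n M) : set 'rV[R]_n :=
  cfun phi @` cdom phi.

(* The atlas need not be maximal. *)
Record smooth_manifold (R : realType) (n : nat) := SmoothManifold {
  carrier :> topologicalType;
  atlas : set (chart R n carrier);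
  atlas_cover : forall p : carrier, exists2 phi, atlas phi & cdom phi p;
  atlas_smooth : forall phi psi, atlas phi -> atlas psi ->
    smooth_on (cfun phi @` (cdom phi `&` cdom psi)) (cfun psi \o cinv phi);
  carrier_hausdorff : hausdorff_space carrier;
  carrier_second_countable : @second_countable carrier
}.

Section Manifold.
Context {R : realType} {n : nat} {M : smooth_manifold R n}.

Definition chart_at (p : M) : chart R n M := s2val (cid2 (atlas_cover p)).

(* A tangent vector at p is represented by its components in the chosen chart
   [chart_at p]; [tcoord] and [tvect] convert from and to components in an
   arbitrary chart around p. *)
Definition tangent (p : M) := 'rV[R]_n.

Definition tcoord (phi : chart R n M) (p : M) (v : tangent p) : 'rV[R]_n :=
  'd (cfun phi \o cinv (chart_at p)) (cfun (chart_at p) p) v.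

Definition tvect (phi : chart R n M) (p : M) (a : 'rV[R]_n) : tangent p :=
  'd (cfun (chart_at p) \o cinv phi) (cfun phi p) a.

Definition dmap (f : M -> M) (p : M) (v : tangent p) : tangent (f p) :=
  'd (cfun (chart_at (f p)) \o f \o cinv (chart_at p)) (cfun (chart_at p) p) v.

Definition smooth_into_on (E : normedModType R) (U : set E) (f : E -> M) : Prop :=
  (forall x, U x -> {for x, continuous f}) /\
  (forall psi : chart R n M, atlas psi ->
     smooth_on (U `&` f @^-1` cdom psi) (cfun psi \o f)).

Definition smooth_curve (c : R -> M) : Prop := smooth_into_on [set: R^o] c.

(* c'(s), in the chart chosen at c s. *)
Definition velocity (c : R -> M) (s : R) : tangent (c s) :=
  derive1 (fun t => cfun (chart_at (c s)) (c t)) s.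

Definition vfield := forall p : M, tangent p.

Definition field_coord (phi : chart R n M) (X : vfield) (y : 'rV[R]_n) : 'rV[R]_n :=
  tcoord phi (X (cinv phi y)).

Definition smooth_vfield (X : vfield) : Prop :=
  forall phi, atlas phi -> smooth_on (cimg phi) (field_coord phi X).

Definition partial (i : 'I_n) (f : 'rV[R]_n -> R) (y : 'rV[R]_n) : R :=
  'D_(delta_mx 0 i) f y.

(* Components g_ij of a metric in the chart phi, on [cimg phi]. *)
Definition gram_of (g : forall p : M, tangent p -> tangent p -> R)
    (phi : chart R n M) (y : 'rV[R]_n) : 'M[R]_n :=
  let p := cinv phi y in
  \matrix_(i, j) g p (tvect phi p (delta_mx 0 i)) (tvect phi p (delta_mx 0 j)).

End Manifold.

Arguments vfield {R n} M.

Record metric (R : realType) (n : nat) (M : smooth_manifold R n) := Metric {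
  inner :> forall p : M, tangent p -> tangent p -> R;
  inner_linear : forall p a (u v w : tangent p),
    inner (a *: u + v) w = a * inner u w + inner v w;
  inner_sym : forall p (u v : tangent p), inner u v = inner v u;
  inner_pos : forall p (u : tangent p), u != 0 -> 0 < inner u u;
  inner_smooth : forall phi, atlas phi -> smooth_on (cimg phi) (gram_of inner phi)
}.

Section Riemannian.
Context {R : realType} {n : nat} {M : smooth_manifold R n}.
Variable g : metric M.

Definition gram (phi : chart R n M) (y : 'rV[R]_n) : 'M[R]_n := gram_of g phi y.

Definition christoffel (phi : chart R n M) (k i j : 'I_n) (y : 'rV[R]_n) : R :=
  2^-1 * \sum_l invmx (gram phi y) k l *
    (partial i (fun z => gram phi z j l) y
     + partial j (fun z => gram phi z i l) y
     - partial l (fun z => gram phi z i j) y).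

(* (DV/ds)^k = dV^k/ds + Gamma^k_ij (dc^i/ds) V^j, in the chart chosen at c s. *)
Definition cov_along (c : R -> M) (V : forall s, tangent (c s)) (s : R) :
    tangent (c s) :=
  let phi := chart_at (c s) in
  let Vphi t := tcoord phi (V t) in
  \row_k (derive1 Vphi s 0 k +
    \sum_i \sum_j christoffel phi k i j (cfun phi (c s)) *
      velocity c s 0 i * Vphi s 0 j).

Definition geodesic (c : R -> M) : Prop :=
  smooth_curve c /\ forall s, cov_along (velocity c) s = 0.

(* Geodesic completeness. Under [c 0 = p] the tangent spaces at c 0 and p share
   the chosen chart, so the last equation compares vectors of the same space. *)
Definition complete_metric : Prop :=
  forall (p : M) (v : tangent p),
    exists c : R -> M, [/\ geodesic c, c 0 = p & velocity c 0 = v].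

(* R(d_i, d_j) d_k = (riemann_coef phi l k i j) d_l, for
   R(U, V) W = D_U D_V W - D_V D_U W - D_[U, V] W. *)
Definition riemann_coef (phi : chart R n M) (l k i j : 'I_n) (y : 'rV[R]_n) : R :=
  partial i (christoffel phi l j k) y - partial j (christoffel phi l i k) y
  + \sum_m (christoffel phi l i m y * christoffel phi m j k y
            - christoffel phi l j m y * christoffel phi m i k y).

Definition curvature (p : M) (u v w : tangent p) : tangent p :=
  let phi := chart_at p in
  \row_l \sum_i \sum_j \sum_k
    riemann_coef phi l k i j (cfun phi p) * u 0 i * v 0 j * w 0 k.

Definition sectional (p : M) (u v : tangent p) : R :=
  g p (curvature u v v) u / (g p u u * g p v v - g p u v ^+ 2).

(* (L_X g)_ij = X^k d_k g_ij + g_kj d_i X^k + g_ik d_j X^k. *)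
Definition lie_metric (X : vfield M) (phi : chart R n M) (y : 'rV[R]_n) : 'M[R]_n :=
  \matrix_(i, j) \sum_k
    (field_coord phi X y 0 k * partial k (fun z => gram phi z i j) y
     + gram phi y k j * partial i (fun z => field_coord phi X z 0 k) y
     + gram phi y i k * partial j (fun z => field_coord phi X z 0 k) y).

Definition killing (X : vfield M) : Prop :=
  smooth_vfield X /\
  forall phi, atlas phi -> forall y, cimg phi y -> lie_metric X phi y = 0.

Definition unit_vfield (X : vfield M) : Prop := forall p, g p (X p) (X p) = 1.

(* Smoothness is joint in (s, p); each gamma s has the smooth inverse gamma (- s). *)
Definition one_parameter_group_of_motions (gamma : R -> M -> M) : Prop :=
  [/\ forall p, gamma 0 p = p,
      forall s t p, gamma (s + t) p = gamma s (gamma t p),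
      forall phi, atlas phi ->
        smooth_into_on [set z : R^o * 'rV[R]_n | cimg phi z.2]
          (fun z => gamma z.1 (cinv phi z.2))
    & forall s p (u v : tangent p),
        g (gamma s p) (dmap (gamma s) u) (dmap (gamma s) v) = g p u v].

Definition generates (X : vfield M) (gamma : R -> M -> M) : Prop :=
  forall p s, velocity (gamma^~ p) s = X (gamma s p).

End Riemannian.

Record riemannian_manifold (R : realType) (n : nat) := RiemannianManifold {
  rmanifold :> smooth_manifold R n;
  rmetric : metric rmanifold;
  rmanifold_connected : connected [set: rmanifold];
  rmetric_complete : complete_metric rmetric
}.

(* Main.v *)
Require Import Defs.
From mathcomp Require Import all_boot all_order all_algebra perm.
From mathcomp Require Import all_classical all_reals all_analysis.
From mathcomp Require Import ring lra.
Import Order.TTheory GRing.Theory Num.Theory.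
Import numFieldNormedType.Exports.
Set Implicit Arguments.
Unset Strict Implicit.
Unset Printing Implicit Defensive.
Local Open Scope classical_set_scope.
Local Open Scope ring_scope.

(** Write A v for the covariant derivative of the field X in the direction v.
The Killing equation says that A is skew for g, and differentiating
g(X, X) = 1 gives g(A v, X) = 0 for all v; together they give A X = 0.

Since Y is carried along by the flow of X, it commutes with X, so that its
derivative along c is A Y.  In a chart this is the equality of the mixed
second derivatives of the map (t, y) |-> gamma_t(y), whose t-derivative is X
evaluated at its value ([cov_along_flow]).

The curvature formula is then a statement about A alone:
g(R(X, a) a, X) = g(A a, A a) ([curvature_cov_field]).  By skewness of the
curvature the left-hand side is - g(a, R(X, a) X), and the Ricci identity
expresses R(X, a) X through second covariant derivatives of X.  These are
eliminated by differentiating the three scalar identities g(A a, a) = 0,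
g(A a, X) = 0 and g(A u, a) + g(u, A a) = 0.

For the constancy there is no need to differentiate along c, nor to
know how Christoffel symbols transform.  Let theta be the 1-form g(., X).
Skewness of A gives 2 g(A a, b) = d theta (a, b) ([cov_chart_exterior]), and
this involves only g and X.  A motion gamma_s preserves g, and it preserves X
by the group law; hence it preserves d theta, because the second derivatives
of gamma_s cancel in the antisymmetrization ([flow_dual_form]).  So gamma_s
intertwines the operator A at x with the one at c(s), and the length of A Y(s)
is that of A w ([flow_cov_norm]).

The same two facts about gamma_s, that it preserves g and X, give the first
two conclusions.  When w is a unit vector orthogonal to X, the denominator
in the sectional curvature of (X, Y) is 1.

All computations take place in charts.  The local argument on unit Killing
fields is made for abstract functions on a normed space that satisfy the rules
of a metric connection; a chart is then shown to supply such functions. *)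

(** * Calculus in normed spaces *)

Section Calculus.
Context {R : realType}.

(** Differentiability is a property of the germ: every map below that comes
from charts is known only on the open set where the charts make sense. *)
Lemma near_eq_differentiable (V W : normedModType R) (f h : V -> W) (x : V) :
  (\near x, f x = h x) -> differentiable f x -> differentiable h x.
Proof.
move=> fh df.
have hE : h \o shift x = cst (h x) + 'd f x +o_ (0 : V) id.
  apply/eqaddoP => e e0.
  have /diff_locally/eqaddoP/(_ e e0) dfe := df.
  have fh0 : \forall z \near (0 : V), f (z + x) = h (z + x).
    move: fh; rewrite (near_shift 0) /=; apply: filterS => z /=.
    by rewrite subr0.
  rewrite -(nbhs_singleton fh).
  apply: filterS2 dfe fh0 => z.
  by rewrite -![(_ - _) z]/(_ - _) /= => + fz; rewrite -fz.
have dh := @diff_unique _ _ _ h ('d f x) x (diff_continuous df) hE.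
by apply/diff_locallyP; rewrite dh; split => //; exact: diff_continuous.
Qed.

Lemma near_eq_diff (V W : normedModType R) (f h : V -> W) x v :
  (\near x, f x = h x) -> differentiable f x -> 'd h x v = 'd f x v.
Proof.
move=> fh fd; have hd := near_eq_differentiable fh fd.
by rewrite -!deriveE //; apply/esym/near_eq_derive.
Qed.

(** The chain rule with the intermediate point given only up to an equation;
in charts that point is computed by cancelling a chart with its inverse. *)
Lemma diff_compE (U V W : normedModType R) (f : V -> W) (h : U -> V) x y v :
  h x = y -> differentiable h x -> differentiable f y ->
  'd (f \o h) x v = 'd f y ('d h x v).
Proof. by move=> <- hd fd; rewrite (diff_comp hd fd). Qed.

Lemma is_derive_line (E W : normedModType R) (f : E -> W) (a u : E) (s : R) df :
  is_derive (a + s *: u) u f df -> is_derive s 1 (fun s => f (a + s *: u)) df.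
Proof.
move=> [fd <-].
have key : (fun h : R => h^-1 *:
      (((fun s0 : R => f (a + s0 *: u)) \o shift s) (h *: (1 : R)) - f (a + s *: u))) =
    (fun h : R => h^-1 *:
      ((f \o shift (a + s *: u)) (h *: u) - f (a + s *: u))).
  apply/funext => h /=; congr (_ *: (f _ - _)).
  by rewrite [h%:A]mulr1 scalerDl addrCA.
by split; rewrite /derivable /derive key.
Qed.

(** The mean value theorem applied twice, first to the increment of [f] in the
direction [v] as a function of the position along [u], then to [fu] along [v]. *)
Lemma second_difference (E : normedModType R) (U : set E) (f fu fuv : E -> R)
    (x u v : E) (h : R) : 0 < h ->
  (forall s t, 0 <= s <= h -> 0 <= t <= h -> U (x + s *: u + t *: v)) ->
  (forall y, U y -> is_derive y u f (fu y)) ->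
  (forall y, U y -> is_derive y v fu (fuv y)) ->
  exists s t, [/\ 0 <= s <= h, 0 <= t <= h &
    f (x + h *: u + h *: v) - f (x + h *: u) - (f (x + h *: v) - f x)
      = fuv (x + s *: u + t *: v) * h * h].
Proof.
move=> h0 Uh dfu dfuv.
have hh : 0 <= h <= h by rewrite (ltW h0) lexx.
have oh : 0 <= (0 : R) <= h by rewrite lexx (ltW h0).
pose k s := f (x + s *: u + h *: v) - f (x + s *: u).
have dk s : 0 <= s <= h ->
    is_derive s 1 k (fu (x + s *: u + h *: v) - fu (x + s *: u)).
  move=> hs; apply: is_deriveB.
    have -> : (fun s => f (x + s *: u + h *: v)) =
              (fun s => f ((x + h *: v) + s *: u)).
      by apply/funext => r; rewrite addrAC.
    by apply: is_derive_line; rewrite addrAC; apply: dfu; apply: Uh.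
  apply: is_derive_line; apply: dfu.
  by have := Uh s 0 hs oh; rewrite scale0r addr0.
have itvW (s : R) : s \in `]0, h[ -> 0 <= s <= h.
  by rewrite in_itv /= => /andP[/ltW -> /ltW ->].
have [|s sh ks] := @MVT R k _ 0 h h0 (fun s hs => dk s (itvW s hs)).
  apply: derivable_within_continuous => s; rewrite in_itv /= => hs.
  by have [] := dk s hs.
have {}sh := itvW _ sh.
pose l t := fu (x + s *: u + t *: v).
have dl t : 0 <= t <= h -> is_derive t 1 l (fuv (x + s *: u + t *: v)).
  by move=> ht; apply: is_derive_line; apply: dfuv; apply: Uh.
have [|t th lt] := @MVT R l _ 0 h h0 (fun s hs => dl s (itvW s hs)).
  apply: derivable_within_continuous => t; rewrite in_itv /= => ht.
  by have [] := dl t ht.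
exists s, t; split => //; first exact: itvW.
move: ks lt; rewrite /k /l !scale0r !addr0 !subr0 => -> <-.
by [].
Qed.

(** The second difference of [f] over a small parallelogram is symmetric in the
two directions, and it is the square of the side times a nearby value of
either mixed derivative; continuity of these at [x] gives the equality. *)
Lemma schwarz (E : normedModType R) (U : set E) (f fu fv fuv fvu : E -> R)
    (x u v : E) : nbhs x U ->
  (forall y, U y -> is_derive y u f (fu y)) ->
  (forall y, U y -> is_derive y v f (fv y)) ->
  (forall y, U y -> is_derive y v fu (fuv y)) ->
  (forall y, U y -> is_derive y u fv (fvu y)) ->
  {for x, continuous fuv} -> {for x, continuous fvu} ->
  fuv x = fvu x.
Proof.
move=> Ux dfu dfv dfuv dfvu cuv cvu.
apply/eqP; rewrite -subr_eq0 -normr_le0; apply/ler_addgt0Pr => e e0.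
rewrite add0r.
have e20 : 0 < e / 2 by rewrite divr_gt0.
have [r r0 rU] : exists2 r : R, 0 < r & ball x r `<=`
    [set y | [/\ U y, `|fuv x - fuv y| < e / 2 & `|fvu x - fvu y| < e / 2]].
  apply/nbhs_ballP.
  have /cvgrPdist_lt/(_ _ e20) n1 := cuv.
  have /cvgrPdist_lt/(_ _ e20) n2 := cvu.
  by near=> y; split; near: y.
(* the summand 1 makes [d] positive, the factor 1/2 in [h] makes a bound strict *)
pose d := `|u| + `|v| + 1.
have d0 : 0 < d by rewrite ltr_wpDl // addr_ge0.
pose h := r / 2 / d.
have h0 : 0 < h by rewrite !divr_gt0.
have small s t : 0 <= s <= h -> 0 <= t <= h -> ball x r (x + s *: u + t *: v).
  move=> /andP[s0 sh] /andP[t0 th]; rewrite -ball_normE /=.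
  rewrite -addrA opprD addrA subrr sub0r normrN.
  apply: (@le_lt_trans _ _ (h * (`|u| + `|v|))).
    rewrite mulrDr (le_trans (ler_normD _ _)) // lerD // normrZ ler_wpM2r //.
      by rewrite ger0_norm.
    by rewrite ger0_norm.
  apply: (@le_lt_trans _ _ (h * d)).
    by rewrite ler_wpM2l ?ltW // /d ltrDl.
  by rewrite /h divfK ?gt_eqF // ltr_pdivrMr // ltr_pMr // ltr1n.
have [s [t [hs ht est]]] := second_difference h0
  (fun s t hs ht => let: And3 a _ _ := rU _ (small s t hs ht) in a) dfu dfuv.
have smallC a b : 0 <= a <= h -> 0 <= b <= h -> ball x r (x + a *: v + b *: u).
  by move=> ha hb; rewrite addrAC; apply: small.
have [s' [t' [hs' ht' est']]] := second_difference h0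
  (fun s t hs ht => let: And3 a _ _ := rU _ (smallC s t hs ht) in a) dfv dfvu.
have eqD : fuv (x + s *: u + t *: v) = fvu (x + s' *: v + t' *: u).
  clearbody h; have hn : h * h != 0 by rewrite mulf_neq0 // gt_eqF.
  apply: (mulIf hn); rewrite !mulrA -est -est'.
  rewrite [x + h *: v + _]addrAC; ring.
have [_ b1 _] := rU _ (small _ _ hs ht).
have [_ _ b2] := rU _ (smallC _ _ hs' ht').
rewrite (splitr e) -(subrKA (fuv (x + s *: u + t *: v))) (le_trans (ler_normD _ _)) //.
by rewrite lerD ?ltW // eqD distrC.
Unshelve. all: by end_near. Qed.

Lemma is_derive_entry (V : normedModType R) m p (F : V -> 'M[R]_(m, p)) x v
    (dF : 'M[R]_(m, p)) i j :
  is_derive x v F dF -> is_derive x v (fun z => F z i j) (dF i j).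
Proof.
by move=> [Fd <-]; split; [exact: (derivable_mxP _ _ _).1|rewrite derive_mx // mxE].
Qed.

Lemma is_derive_mx (V : normedModType R) m p (F : V -> 'M[R]_(m, p)) x v
    (dF : 'M[R]_(m, p)) :
  (forall i j, is_derive x v (fun z => F z i j) (dF i j)) -> is_derive x v F dF.
Proof.
move=> Fd; have Fdv : derivable F x v.
  by apply/derivable_mxP => i j; have [] := Fd i j.
split=> //; rewrite derive_mx //; apply/matrixP => i j; rewrite mxE.
by have [] := Fd i j.
Qed.

Lemma differentiable_entry (V : normedModType R) m p (F : V -> 'M[R]_(m, p)) x i j :
  differentiable F x -> differentiable (fun z => F z i j) x.
Proof.
by move=> Fd; exact: (differentiable_comp Fd (differentiable_coord (F x) i j)).
Qed.

Lemma is_derive_diff (V W : normedModType R) (f : V -> W) x v :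
  differentiable f x -> is_derive x v f ('D_v f x).
Proof. by move=> fd; split => //; exact: diff_derivable. Qed.

(** Linearity of the differential; directional derivatives are used everywhere
below, and partial derivatives only to meet coordinate formulas. *)
Lemma derive_partials n (W : normedModType R) (f : 'rV[R]_n -> W) x u :
  differentiable f x -> 'D_u f x = \sum_i u 0 i *: 'D_(delta_mx 0 i) f x.
Proof.
move=> fd; rewrite {1}(row_sum_delta u) deriveE // linear_sum.
by apply: eq_bigr => i _; rewrite linearZ deriveE.
Qed.

Lemma is_derive_comp (U V W : normedModType R) (f : V -> W) (h : U -> V) x v :
  differentiable h x -> differentiable f (h x) ->
  is_derive x v (fun z => f (h z)) ('D_('D_v h x) f (h x)).
Proof.
move=> hd fd.
have fhd : differentiable (f \o h) x by exact: differentiable_comp.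
split; first exact: diff_derivable.
by rewrite (deriveE _ fhd) diff_comp // deriveE // (deriveE _ hd).
Qed.

(** Reduction to the scalar case, entry by entry. *)
Lemma Ck_on_schwarz (E : normedModType R) m p (U : set E) (F : E -> 'M[R]_(m, p))
    (x u v : E) : nbhs x U -> Ck_on 2 U F ->
  'D_v ('D_u F) x = 'D_u ('D_v F) x.
Proof.
move=> Ux [Fd F1]; apply/matrixP => i j.
have dd w w' y : U y -> is_derive y w' (fun z => 'D_w F z i j) ('D_w' ('D_w F) y i j).
  by move=> Uy; apply/is_derive_entry/is_derive_diff; have [+ _] := F1 w; exact.
apply: (@schwarz _ U (fun z => F z i j) (fun z => 'D_u F z i j)
  (fun z => 'D_v F z i j) (fun z => 'D_v ('D_u F) z i j)
  (fun z => 'D_u ('D_v F) z i j) x u v) => //.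
- by move=> y Uy; apply/is_derive_entry/is_derive_diff/Fd.
- by move=> y Uy; apply/is_derive_entry/is_derive_diff/Fd.
- have := (F1 u).2 v x (nbhs_singleton Ux).
  by move=> c; exact: (continuous_comp c (@coord_continuous _ _ _ i j _)).
- have := (F1 v).2 u x (nbhs_singleton Ux).
  by move=> c; exact: (continuous_comp c (@coord_continuous _ _ _ i j _)).
Qed.

(** * Bilinear forms with variable coefficients *)

Definition bil n (C : 'M[R]_n) (u v : 'rV[R]_n) : R :=
  \sum_i \sum_j C i j * u 0 i * v 0 j.

Section Bil.
Context {n : nat}.
Implicit Types (C : 'M[R]_n) (u v w : 'rV[R]_n).

Lemma bil_sum C u v : bil C u v = \sum_i \sum_j C i j * u 0 i * v 0 j.
Proof. by []. Qed.

Lemma bilE C u v : bil C u v = (u *m C *m v^T) 0 0.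
Proof.
rewrite /bil mxE exchange_big; apply: eq_bigr => j _; rewrite !mxE big_distrl.
by apply: eq_bigr => i _; rewrite /= (mulrC (C i j)).
Qed.

Lemma bil_congr C u u' v v' :
  u = u' -> v = v' -> bil C u v = bil C u' v'.
Proof. by move=> -> ->. Qed.

Lemma bilDl C u v w : bil C (u + v) w = bil C u w + bil C v w.
Proof. by rewrite !bilE !mulmxDl mxE. Qed.

Lemma bilDr C u v w : bil C u (v + w) = bil C u v + bil C u w.
Proof. by rewrite !bilE linearD /= !mulmxDr mxE. Qed.

Lemma bilZl C (a : R) u v : bil C (a *: u) v = a * bil C u v.
Proof. by rewrite !bilE -!scalemxAl mxE. Qed.

Lemma bilZr C (a : R) u v : bil C u (a *: v) = a * bil C u v.
Proof. by rewrite !bilE linearZ /= -!scalemxAr mxE. Qed.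

Lemma bilNl C u v : bil C (- u) v = - bil C u v.
Proof. by rewrite -scaleN1r bilZl mulN1r. Qed.

Lemma bil0l C v : bil C 0 v = 0.
Proof. by rewrite -(scale0r 0) bilZl mul0r. Qed.

Lemma bil0r C v : bil C v 0 = 0.
Proof. by rewrite -(scale0r 0) bilZr mul0r. Qed.

Lemma is_derive_bil (V : normedModType R) (C : V -> 'M[R]_n) (f h : V -> 'rV[R]_n)
    (x w : V) (dC : 'M[R]_n) (df dh : 'rV[R]_n) :
  is_derive x w C dC -> is_derive x w f df -> is_derive x w h dh ->
  is_derive x w (fun z => bil (C z) (f z) (h z))
    (bil dC (f x) (h x) + bil (C x) df (h x) + bil (C x) (f x) dh).
Proof.
move=> Cd fd hd.
have bE : (fun z => bil (C z) (f z) (h z)) =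
    \sum_i \sum_j ((fun z => C z i j) * (fun z => f z 0 i) * (fun z => h z 0 j)).
  apply/funext => z; rewrite /bil fct_sumE; apply: eq_bigr => i _.
  by rewrite fct_sumE; apply: eq_bigr.
rewrite bE; apply: is_derive_eq.
  apply: is_derive_sum => i; apply: is_derive_sum => j; apply: is_deriveM.
    apply: is_deriveM; first exact: (is_derive_entry i j Cd).
    exact: (is_derive_entry 0 i fd).
  exact: (is_derive_entry 0 j hd).
rewrite /bil -!big_split; apply: eq_bigr => i _; rewrite -!big_split.
apply: eq_bigr => j _ /=; rewrite /GRing.scale /=.
rewrite -![((_ : V -> R) * _) _]/(_ * _) /=; ring.
Qed.

Lemma is_derive_bil_cst (V : normedModType R) (C : V -> 'M[R]_n) u v
    (x w : V) (dC : 'M[R]_n) :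
  is_derive x w C dC -> is_derive x w (fun z => bil (C z) u v) (bil dC u v).
Proof.
move=> Cd; have := is_derive_bil Cd (is_derive_cst u x w) (is_derive_cst v x w).
by rewrite bil0l bil0r !addr0.
Qed.

End Bil.
End Calculus.

(** * Change of charts and tangent vectors *)

Section Charts.
Context {R : realType} {n : nat} {M : smooth_manifold R n}.
Implicit Types (phi psi chi : chart R n M) (p q : M).

Lemma atlas_chart_at p : atlas (chart_at p).
Proof. by rewrite /chart_at; case: cid2. Qed.

Lemma cdom_chart_at p : cdom (chart_at p) p.
Proof. by rewrite /chart_at; case: cid2. Qed.

Lemma cimg_cfun phi p : cdom phi p -> cimg phi (cfun phi p).
Proof. by move=> pd; exists p. Qed.

Lemma cdom_cinv phi y : cimg phi y -> cdom phi (cinv phi y).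
Proof. by move=> [p pd <-]; rewrite cfunK. Qed.

Lemma cinvK phi y : cimg phi y -> cfun phi (cinv phi y) = y.
Proof. by move=> [p pd <-]; rewrite cfunK. Qed.

Lemma near_cimg phi y : cimg phi y -> \forall z \near y, cimg phi z.
Proof. by move=> yi; apply: open_nbhs_nbhs; split=> //; exact: cimg_open. Qed.

Lemma near_cdom phi p : cdom phi p -> \forall q \near p, cdom phi q.
Proof. by move=> yi; apply: open_nbhs_nbhs; split=> //; exact: cdom_open. Qed.

Lemma near_cinv phi p (P : set M) : cdom phi p -> nbhs p P ->
  \forall y \near cfun phi p, P (cinv phi y).
Proof.
move=> pd nP; have := @cinv_continuous _ _ _ phi _ (cimg_cfun pd).
by move=> /(_ P); apply; rewrite cfunK.
Qed.

Lemma differentiable_trans phi psi p : atlas phi -> atlas psi ->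
  cdom phi p -> cdom psi p ->
  differentiable (cfun psi \o cinv phi) (cfun phi p).
Proof.
move=> ap aq pp pq; have [+ _] := atlas_smooth ap aq 1%N.
by apply; exists p.
Qed.

(** Both the change of components of a tangent vector and the independence of
a differential from the chart are instances of this: the target of [h] may be
another chart, or another chart after a map of the manifold. *)
Lemma diff_chart_change (W : normedModType R) (h : M -> W) phi psi p :
  atlas phi -> atlas psi -> cdom phi p -> cdom psi p ->
  differentiable (h \o cinv psi) (cfun psi p) ->
  differentiable (h \o cinv phi) (cfun phi p) /\
  (forall v, 'd (h \o cinv phi) (cfun phi p) v =
     'd (h \o cinv psi) (cfun psi p) ('d (cfun psi \o cinv phi) (cfun phi p) v)).
Proof.
move=> ap aq pp pq hd.
have td := differentiable_trans ap aq pp pq.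
have tp : (cfun psi \o cinv phi) (cfun phi p) = cfun psi p by rewrite /= cfunK.
have hd' : differentiable (h \o cinv psi) ((cfun psi \o cinv phi) (cfun phi p)).
  by rewrite tp.
have nE : \forall y \near cfun phi p,
    ((h \o cinv psi) \o (cfun psi \o cinv phi)) y = (h \o cinv phi) y.
  by apply: filterS (near_cinv pp (near_cdom pq)) => y yd /=; rewrite cfunK.
have cd := differentiable_comp td hd'.
split; first exact: near_eq_differentiable nE cd.
move=> v; apply: (etrans (near_eq_diff v nE cd)).
exact: diff_compE.
Qed.

Lemma diff_chart_id phi p v : cdom phi p ->
  'd (cfun phi \o cinv phi) (cfun phi p) v = v.
Proof.
move=> pd.
have nE : \forall y \near cfun phi p, id y = (cfun phi \o cinv phi) y.
  apply: filterS (near_cimg (cimg_cfun pd)) => y yi /=.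
  by rewrite cinvK.
have did : differentiable (id : 'rV[R]_n -> 'rV[R]_n) (cfun phi p) by [].
by rewrite (near_eq_diff v nE did) diff_val.
Qed.

Lemma tvectK phi p (a : 'rV[R]_n) : atlas phi -> cdom phi p ->
  tcoord phi (tvect phi p a) = a.
Proof.
move=> ap pp; have pc := cdom_chart_at p; have ac := atlas_chart_at p.
apply: etrans (diff_chart_id a pp); apply: esym.
by have [_] := diff_chart_change ap ac pp pc (differentiable_trans ac ap pc pp); apply.
Qed.

Lemma tcoordK phi p (v : tangent p) : atlas phi -> cdom phi p ->
  tvect phi p (tcoord phi v) = v.
Proof.
move=> ap pp; have pc := cdom_chart_at p; have ac := atlas_chart_at p.
apply: etrans (diff_chart_id v pc); apply: esym.
by have [_] := diff_chart_change ac ap pc pp (differentiable_trans ap ac pp pc); apply.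
Qed.

Lemma tcoord_chart_at p (v : tangent p) : tcoord (chart_at p) v = v.
Proof. exact: diff_chart_id (cdom_chart_at p). Qed.

Lemma field_coord_cfun phi (X : vfield M) p : cdom phi p ->
  field_coord phi X (cfun phi p) = tcoord phi (X p).
Proof. by move=> pp; rewrite /field_coord cfunK. Qed.

Variable g : metric M.

Lemma inner_bil p (f : 'I_n -> tangent p) (a b : 'rV[R]_n) :
  g p (\sum_i a 0 i *: f i) (\sum_i b 0 i *: f i) =
  bil (\matrix_(i, j) g p (f i) (f j)) a b.
Proof.
have l0 w : g p 0 w = 0.
  by have := inner_linear g 1 0 0 w; rewrite scaler0 addr0 mul1r => /eqP;
     rewrite -subr_eq0 opprD addrA subrr sub0r oppr_eq0 => /eqP.
have lsum (c : 'rV[R]_n) w :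
    g p (\sum_i c 0 i *: f i) w = \sum_i c 0 i * g p (f i) w.
  elim/big_ind2 : _ => [|r1 x1 r2 x2 h1 h2|i _].
  - exact: l0.
  - by have := inner_linear g 1 x1 x2 w; rewrite scale1r mul1r h1 h2.
  - by have := inner_linear g (c 0 i) (f i) 0 w; rewrite !addr0 l0 addr0.
rewrite lsum /bil; apply: eq_bigr => i _.
rewrite inner_sym lsum big_distrr; apply: eq_bigr => j _ /=.
by rewrite mxE (inner_sym g (f j)); ring.
Qed.

(** Expand both vectors on the coordinate frame at [p]. *)
Lemma inner_gram phi p (u v : tangent p) : atlas phi -> cdom phi p ->
  g p u v = bil (gram g phi (cfun phi p)) (tcoord phi u) (tcoord phi v).
Proof.
move=> ap pp; rewrite /gram /gram_of cfunK // -inner_bil.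
have tl (a : 'rV[R]_n) : \sum_i a 0 i *: tvect phi p (delta_mx 0 i) = tvect phi p a.
  rewrite {2}(row_sum_delta a) /tvect linear_sum; apply: eq_bigr => i _.
  by rewrite linearZ.
by rewrite !tl !tcoordK.
Qed.

Lemma gram_sym phi y i j : gram g phi y i j = gram g phi y j i.
Proof. by rewrite !mxE inner_sym. Qed.

Lemma gram_nondeg phi y (u : 'rV[R]_n) : atlas phi -> cimg phi y ->
  bil (gram g phi y) u u = 0 -> u = 0.
Proof.
move=> ap [p pp <-] u0; apply/eqP/negPn/negP => un0.
have tn0 : tvect phi p u != 0 :> tangent p.
  apply: contra un0 => /eqP t0; rewrite -(tvectK u ap pp) t0.
  by rewrite /tcoord linear0.
have := inner_pos g tn0.
by rewrite (inner_gram _ _ ap pp) tvectK // u0 ltxx.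
Qed.

(** A vector in the kernel of the Gram matrix would have length zero. *)
Lemma gram_unit phi y : atlas phi -> cimg phi y -> gram g phi y \in unitmx.
Proof.
move=> ap yi; rewrite -row_free_unit -kermx_eq0; apply/rowV0P => v /sub_kermxP vG.
by apply: (gram_nondeg ap yi); rewrite bilE vG mul0mx mxE.
Qed.

End Charts.

(** * The Levi-Civita connection in a chart *)

(** Contraction with the matrix cancels the inverse matrix in the definition
of the Christoffel symbols. *)
Lemma mulVmx_row (R : realType) n (A : 'M[R]_n) (T : 'I_n -> R) (a : R) l :
  A \in unitmx ->
  \sum_k A l k * (a * \sum_m invmx A k m * T m) = a * T l.
Proof.
move=> Au; have inv m : \sum_k A l k * invmx A k m = (l == m)%:R.
  by have := congr1 (fun B : 'M[R]_n => B l m) (mulmxV Au); rewrite !mxE.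
transitivity (\sum_m (\sum_k A l k * invmx A k m) * (a * T m)).
  under [RHS]eq_bigr do rewrite big_distrl.
  rewrite [RHS]exchange_big; apply: eq_bigr => k _ /=.
  rewrite mulrA big_distrr /=; apply: eq_bigr => m _; ring.
rewrite (bigD1 l) //= inv eqxx mul1r big1 ?addr0 // => m ml.
by rewrite inv eq_sym (negPf ml) mul0r.
Qed.

Lemma bil_row_bil (R : realType) n (A : 'M[R]_n) (C : 'I_n -> 'M[R]_n) u v w :
  bil A (\row_k bil (C k) u v) w =
  \sum_i \sum_j \sum_l (\sum_k A k l * C k i j) * u 0 i * v 0 j * w 0 l.
Proof.
transitivity (\sum_l \sum_i \sum_j
    (\sum_k A k l * C k i j) * u 0 i * v 0 j * w 0 l); last first.
  by rewrite exchange_big; apply: eq_bigr => i _; exact: exchange_big.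
rewrite {1}/bil exchange_big; apply: eq_bigr => l _ /=.
under eq_bigr do rewrite mxE /bil big_distrr big_distrl /=.
rewrite exchange_big; apply: eq_bigr => i _ /=.
under eq_bigr do rewrite big_distrr big_distrl /=.
rewrite exchange_big; apply: eq_bigr => j _ /=.
by rewrite !big_distrl /=; apply: eq_bigr => k _; ring.
Qed.

(** For [d i j l] the i-th partial derivative of the entry (j, l) of the metric,
this is the derivative of the metric in the direction [u], evaluated on
[v] and [w]. *)
Definition trilin (R : realType) n (d : 'I_n -> 'I_n -> 'I_n -> R) (u v w : 'rV[R]_n) :=
  \sum_i \sum_j \sum_l d i j l * u 0 i * v 0 j * w 0 l.

(** Lowering the index of the Christoffel symbols turns their definition into
the Koszul formula for constant vector fields. *)
Lemma koszul_algebra (R : realType) n (A : 'M[R]_n)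
    (d : 'I_n -> 'I_n -> 'I_n -> R) (u v w : 'rV[R]_n) :
  A \in unitmx -> (forall i j, A i j = A j i) ->
  2 * bil A (\row_k bil (\matrix_(i, j) (2^-1 * \sum_l invmx A k l *
      (d i j l + d j i l - d l i j))) u v) w =
  trilin d u v w + trilin d v u w - trilin d w u v.
Proof.
move=> Au As.
rewrite bil_row_bil big_distrr.
have -> : trilin d v u w = \sum_i \sum_j \sum_l d j i l * u 0 i * v 0 j * w 0 l.
  by rewrite /trilin exchange_big; do 3!(apply: eq_bigr => ? _); ring.
have -> : trilin d w u v = \sum_i \sum_j \sum_l d l i j * u 0 i * v 0 j * w 0 l.
  rewrite /trilin exchange_big; apply: eq_bigr => i _; rewrite exchange_big.
  by do 2!(apply: eq_bigr => ? _); ring.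
rewrite -big_split -sumrB; apply: eq_bigr => i _.
rewrite big_distrr -big_split -sumrB; apply: eq_bigr => j _.
rewrite big_distrr -big_split -sumrB; apply: eq_bigr => l _ /=.
under eq_bigr do rewrite mxE As.
rewrite (mulVmx_row (fun l => d i j l + d j i l - d l i j) 2^-1 l Au).
by field.
Qed.

Section LeviCivita.
Context {R : realType} {n : nat} {M : smooth_manifold R n}.
Variables (g : metric M) (phi : chart R n M).
Hypothesis aphi : atlas phi.
Local Notation G := (gram g phi).
Implicit Types (y u v w z : 'rV[R]_n).

Lemma gram_C2 : Ck_on 2 (cimg phi) G.
Proof. exact: inner_smooth. Qed.

Lemma gram_diff y : cimg phi y -> differentiable G y.
Proof. exact: gram_C2.1. Qed.

Lemma dgram_diff y u : cimg phi y -> differentiable ('D_u G) y.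
Proof. exact: (gram_C2.2 u).1. Qed.

Lemma partial_gram i j l y : cimg phi y ->
  partial i (fun z => G z j l) y = 'D_(delta_mx 0 i) G y j l.
Proof.
move=> yi; have := is_derive_diff (delta_mx 0 i) (gram_diff yi).
by move=> /(is_derive_entry j l) /@derive_val.
Qed.

Lemma bil_gramC y u v : bil (G y) u v = bil (G y) v u.
Proof.
rewrite !bil_sum exchange_big; apply: eq_bigr => j _; apply: eq_bigr => i _ /=.
by rewrite gram_sym; ring.
Qed.

Lemma bil_dgram y u v w : cimg phi y ->
  bil ('D_u G y) v w = trilin (fun i j l => partial i (fun z => G z j l) y) u v w.
Proof.
move=> yi; rewrite (derive_partials u (gram_diff yi)). rewrite !bil_sum.
rewrite [RHS]exchange_big /=; apply: eq_bigr => j _.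
rewrite [RHS]exchange_big /=; apply: eq_bigr => l _.
rewrite summxE !big_distrl; apply: eq_bigr => i _ /=.
by rewrite mxE partial_gram //; ring.
Qed.

(** The Christoffel symbols as a bilinear map: the covariant derivative in the
direction [u] of the constant field [v]. *)
Definition christoffel_form y u v : 'rV[R]_n :=
  \row_k bil (\matrix_(i, j) christoffel g phi k i j y) u v.
Local Notation Gam := christoffel_form.

Lemma koszul y u v w : cimg phi y ->
  2 * bil (G y) (Gam y u v) w =
  bil ('D_u G y) v w + bil ('D_v G y) u w - bil ('D_w G y) u v.
Proof.
move=> yi; apply: etrans (koszul_algebra (fun i j l => partial i (fun z => G z j l) y)
  u v w (gram_unit g aphi yi) (gram_sym g phi y)) _.
congr (_ + _ - _); apply: esym; exact: bil_dgram.
Qed.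

Lemma bil_dgramC y u v w : cimg phi y -> bil ('D_u G y) v w = bil ('D_u G y) w v.
Proof.
move=> yi; apply: etrans (bil_dgram u v w yi) _.
apply: etrans (esym (bil_dgram u w v yi)); apply: eq_bigr => i _.
rewrite exchange_big; apply: eq_bigr => j _; apply: eq_bigr => l _.
have -> : (fun z => G z l j) = (fun z => G z j l).
  by apply/funext => z; rewrite gram_sym.
by rewrite mulrAC.
Qed.

(** Add the Koszul formulas for (u, v, w) and (u, w, v): the terms that are
antisymmetric in [v] and [w] cancel. *)
Lemma metric_compat y u v w : cimg phi y ->
  bil ('D_u G y) v w = bil (G y) (Gam y u v) w + bil (G y) v (Gam y u w).
Proof.
move=> yi; apply: esym.
apply: etrans (congr1 (fun r => bil (G y) (Gam y u v) w + r)
  (bil_gramC y v (Gam y u w))) _.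
have lin (a a' b c p q : R) : 2 * p = a + b - c -> 2 * q = a' + c - b ->
    a = a' -> p + q = a.
  by move=> hp hq aa; lra.
exact: lin (koszul u v w yi) (koszul u w v yi) (bil_dgramC u v w yi).
Qed.

Lemma christoffelC k i j y : christoffel g phi k i j y = christoffel g phi k j i y.
Proof.
rewrite /christoffel; congr (_ * _); apply: eq_bigr => l _.
have -> : (fun z => G z i j) = (fun z => G z j i).
  by apply/funext => z; rewrite gram_sym.
by rewrite (addrC (partial i _ _)).
Qed.

Lemma christoffel_formC y u v : Gam y u v = Gam y v u.
Proof.
apply/rowP => k; rewrite !mxE !bil_sum exchange_big; apply: eq_bigr => i _.
by apply: eq_bigr => j _ /=; rewrite !mxE christoffelC; ring.
Qed.

Lemma christoffel_formDl y u v w : Gam y (u + v) w = Gam y u w + Gam y v w.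
Proof. by apply/rowP => k; rewrite !mxE bilDl. Qed.

End LeviCivita.

(** * Unit Killing fields for an abstract connection *)

Lemma sub_crossed_terms (V : zmodType) (x y z a b c d : V) :
  x + (a + y) + (z + b) - (x + (c + z) + (y + d)) = a - c + b - d.
Proof.
rewrite (AC ((1 * 2) * 2) ((1 * 3 * 4) * (2 * 5)))%AC.
rewrite [x + (c + z) + _](AC ((1 * 2) * 2) ((1 * 4 * 3) * (2 * 5)))%AC.
by rewrite opprD addrACA subrr add0r opprD addrACA addrA.
Qed.

(** The data of a metric connection on an open subset [U] of a normed space:
[gd y] is the metric at [y], [Gam y u v] the covariant derivative of the
constant field [v] along [u], and [dGam y u v w] the derivative of
[Gam z v w] at [z = y] in the direction [u].  The hypothesis [gd_deriv] is
compatibility of metric and connection, and [gd_schwarz] is the symmetry of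
the second derivatives of the metric, whose first derivatives are expressed
through [Gam].  Stating the argument for such abstract functions keeps it free
of indices and of partial derivatives. *)
Section KillingLocal.
Context {R : realType} {E : normedModType R}.
Variables (U : set E) (gd : E -> E -> E -> R) (Gam : E -> E -> E -> E).
Variables (dGam : E -> E -> E -> E -> E) (xi : E -> E).
Hypothesis U_open : forall y, U y -> \forall z \near y, U z.
Hypothesis gdC : forall y u v, gd y u v = gd y v u.
Hypothesis gdDl : forall y u v w, gd y (u + v) w = gd y u w + gd y v w.
Hypothesis gdNl : forall y u w, gd y (- u) w = - gd y u w.
Hypothesis gd_nondeg : forall y u, U y -> gd y u u = 0 -> u = 0.
Hypothesis GamC : forall y u v, Gam y u v = Gam y v u.
Hypothesis GamDl : forall y u v w, Gam y (u + v) w = Gam y u w + Gam y v w.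
Hypothesis gd_deriv : forall y u (f h : E -> E) df dh, U y ->
  is_derive y u f df -> is_derive y u h dh ->
  is_derive y u (fun z => gd z (f z) (h z))
    (gd y (df + Gam y u (f y)) (h y) + gd y (f y) (dh + Gam y u (h y))).
Hypothesis Gam_deriv : forall y u (f h : E -> E) df dh, U y ->
  is_derive y u f df -> is_derive y u h dh ->
  is_derive y u (fun z => Gam z (f z) (h z))
    (dGam y u (f y) (h y) + Gam y df (h y) + Gam y (f y) dh).
Hypothesis gd_schwarz : forall y u v w t, U y ->
  'D_u (fun z => gd z (Gam z v w) t + gd z w (Gam z v t)) y =
  'D_v (fun z => gd z (Gam z u w) t + gd z w (Gam z u t)) y.
Hypothesis xi_diff : forall y, U y -> differentiable xi y.
Hypothesis dxi_diff : forall y v, U y -> differentiable ('D_v xi) y.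
Hypothesis xi_schwarz : forall y u v, U y ->
  'D_u ('D_v xi) y = 'D_v ('D_u xi) y.

(** The operator A of the introduction: the covariant derivative of [xi]. *)
Definition cov_field y u := 'D_u xi y + Gam y u (xi y).
Local Notation A := cov_field.

(** R(u, v) w for constant fields, whose brackets vanish. *)
Definition riem y u v w :=
  dGam y u v w - dGam y v u w + Gam y u (Gam y v w) - Gam y v (Gam y u w).

(** The derivative in the direction [u] of the vector field A a, for constant
[a]; its covariant derivative has the further term [Gam y u (cov_field y a)]. *)
Definition cov2_field y u a := 'D_u ('D_a xi) y + (dGam y u a (xi y) +
  Gam y a ('D_u xi y)).

Let gdDr y u v w : gd y w (u + v) = gd y w u + gd y w v.
Proof. by rewrite gdC gdDl !(gdC _ w). Qed.

Let gdNr y u w : gd y w (- u) = - gd y w u.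
Proof. by rewrite gdC gdNl gdC. Qed.

Let gd0l y w : gd y 0 w = 0.
Proof. by rewrite -(subrr w) gdDl gdNl subrr. Qed.

Let Gam0l y u : Gam y 0 u = 0.
Proof. by apply: (addrI (Gam y 0 u)); rewrite -GamDl !addr0. Qed.

Let Gam0r y u : Gam y u 0 = 0.
Proof. by rewrite GamC Gam0l. Qed.

Let GamDr y u v w : Gam y w (u + v) = Gam y w u + Gam y w v.
Proof. by rewrite GamC GamDl !(GamC _ w). Qed.

Lemma is_derive_cov_field y u a : U y ->
  is_derive y u (fun z => A z a) (cov2_field y u a).
Proof.
move=> Uy; apply: is_deriveD; first exact: is_derive_diff (dxi_diff a Uy).
have := Gam_deriv Uy (is_derive_cst a y u) (is_derive_diff u (xi_diff Uy)).
by rewrite Gam0l addr0.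
Qed.

Lemma derive_near_cst (f : E -> R) c y u df : U y ->
  (forall z, U z -> f z = c) -> is_derive y u f df -> df = 0.
Proof.
move=> Uy fc fd; rewrite -(@derive_val _ _ _ _ _ _ _ fd).
rewrite (@near_eq_derive _ _ _ f (cst c)) ?derive_cst //.
by apply: filterS (U_open Uy) => z /fc.
Qed.

(** The second derivatives of [xi] cancel by symmetry, and the terms with first
derivatives of [xi] cancel in pairs. *)
Lemma ricci_identity y u v : U y ->
  cov2_field y u v + Gam y u (A y v) - (cov2_field y v u + Gam y v (A y u)) =
  riem y u v (xi y).
Proof.
move=> Uy; rewrite /cov2_field /cov_field /riem (xi_schwarz u v Uy) !GamDr.
exact: sub_crossed_terms.
Qed.

(** The commutator of two derivatives of the function [gd z w t] is zero;
expanded with compatibility it is the sum on the left. *)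
Lemma riem_skew y u v w t : U y ->
  gd y (riem y u v w) t + gd y w (riem y u v t) = 0.
Proof.
move=> Uy; have der a b : is_derive y a
    (fun z => gd z (Gam z b w) t + gd z w (Gam z b t))
    (gd y (dGam y a b w + Gam y a (Gam y b w)) t + gd y (Gam y b w) (Gam y a t) +
     (gd y (Gam y a w) (Gam y b t) + gd y w (dGam y a b t + Gam y a (Gam y b t)))).
  have dG s : is_derive y a (fun z => Gam z b s) (dGam y a b s).
    have := Gam_deriv Uy (is_derive_cst b y a) (is_derive_cst s y a).
    by rewrite Gam0l Gam0r !addr0.
  apply: is_deriveD.
    by have := gd_deriv Uy (dG w) (is_derive_cst t y a); rewrite add0r.
  by have := gd_deriv Uy (is_derive_cst w y a) (dG t); rewrite add0r.
have := gd_schwarz u v w t Uy.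
rewrite (@derive_val _ _ _ _ _ _ _ (der u v)) (@derive_val _ _ _ _ _ _ _ (der v u)).
rewrite /riem !(gdDl, gdDr, gdNl, gdNr) => h; lra.
Qed.

(** The exterior derivative of the 1-form [gd y _ (xi y)]: the connection drops
out because it is torsion-free. *)
Lemma dual_form_exterior y a b : U y ->
  'D_a (fun z => gd z b (xi z)) y - 'D_b (fun z => gd z a (xi z)) y =
  gd y b (A y a) - gd y a (A y b).
Proof.
move=> Uy; have der u v := gd_deriv Uy (is_derive_cst v y u) (is_derive_diff u (xi_diff Uy)).
rewrite (@derive_val _ _ _ _ _ _ _ (der a b)) (@derive_val _ _ _ _ _ _ _ (der b a)).
rewrite !add0r (GamC y b a) /cov_field; lra.
Qed.

Hypothesis xi_killing : forall y u v, U y ->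
  'D_(xi y) (fun z => gd z u v) y + gd y ('D_u xi y) v + gd y u ('D_v xi y) = 0.
Hypothesis xi_unit : forall y, U y -> gd y (xi y) (xi y) = 1.

Lemma cov_field_skew y u v : U y -> gd y (A y u) v = - gd y u (A y v).
Proof.
move=> Uy; have der := gd_deriv Uy (is_derive_cst u y (xi y)) (is_derive_cst v y (xi y)).
have := xi_killing u v Uy; rewrite (@derive_val _ _ _ _ _ _ _ der) !add0r.
by rewrite /cov_field gdDl gdDr !(GamC y (xi y)) => h; lra.
Qed.

Lemma cov_field_perp y u : U y -> gd y (A y u) (xi y) = 0.
Proof.
move=> Uy; have dxi := is_derive_diff u (xi_diff Uy).
have := derive_near_cst Uy xi_unit (gd_deriv Uy dxi dxi).
by rewrite -/(A y u) (gdC _ (xi y)) => h; lra.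
Qed.

Lemma cov_field_self y : U y -> A y (xi y) = 0.
Proof.
move=> Uy; apply: (gd_nondeg Uy).
by rewrite cov_field_skew // gdC cov_field_perp // oppr0.
Qed.

(** In the proof, [e2], [e3] and [e4] are the derivatives of the identities
g(A a, xi) = 0, g(A a, a) = 0 and g(A x0, a) + g(x0, A a) = 0, where [x0] is the
value of [xi] at [y], kept constant. *)
Lemma curvature_cov_field y a : U y ->
  gd y (riem y (xi y) a a) (xi y) = gd y (A y a) (A y a).
Proof.
move=> Uy; set x0 := xi y.
have A0 : A y x0 = 0 by exact: cov_field_self.
have dA u b := is_derive_cov_field u b Uy.
have e1 : gd y (riem y x0 a a) x0 = - gd y a (riem y x0 a x0).
  by have := riem_skew x0 a a x0 Uy; lra.
have e2 : gd y (cov2_field y a a + Gam y a (A y a)) x0 + gd y (A y a) (A y a) = 0.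
  have perp z : U z -> gd z (A z a) (xi z) = 0 by exact: cov_field_perp.
  exact: derive_near_cst Uy perp (gd_deriv Uy (dA a a) (is_derive_diff a (xi_diff Uy))).
have e3 : gd y (cov2_field y x0 a + Gam y x0 (A y a)) a +
    gd y (A y a) (Gam y x0 a) = 0.
  have sk z : U z -> gd z (A z a) a = 0.
    by move=> Uz; have := cov_field_skew a a Uz; rewrite (gdC _ a) => h; lra.
  have := derive_near_cst Uy sk (gd_deriv Uy (dA x0 a) (is_derive_cst a y x0)).
  by rewrite add0r.
have e4 : gd y (cov2_field y a x0) a + gd y (Gam y a x0) (A y a)
    + gd y x0 (cov2_field y a a + Gam y a (A y a)) = 0.
  have sk z : U z -> gd z (A z x0) a + gd z x0 (A z a) = 0.
    by move=> Uz; rewrite cov_field_skew // addNr.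
  have := derive_near_cst Uy sk (is_deriveD
    (gd_deriv Uy (dA a x0) (is_derive_cst a y a))
    (gd_deriv Uy (is_derive_cst x0 y a) (dA a a))).
  by rewrite /= A0 Gam0r gd0l !add0r !addr0 addrA.
have e5 : cov2_field y x0 a + Gam y x0 (A y a) -
    (cov2_field y a x0 + Gam y a (A y x0)) = riem y x0 a x0.
  exact: ricci_identity.
clearbody x0.
rewrite e1 -e5 A0 Gam0r addr0; move: e2 e3 e4 => {dA e1 e5 A0}.
move: (A y a) (cov2_field y a a) (cov2_field y x0 a) (cov2_field y a x0).
move=> b caa cxa cax; rewrite (GamC y a x0) !(gdDl, gdDr, gdNr).
rewrite (gdC y caa x0) (gdC y (Gam y a b) x0) (gdC y cxa a) (gdC y cax a).
by rewrite (gdC y (Gam y x0 b) a) (gdC y (Gam y x0 a) b) => *; lra.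
Qed.

End KillingLocal.

(** * Christoffel symbols and curvature in a chart *)

Section DiffInv.
Context {R : realType} {V : normedModType R}.

Lemma differentiable_bigsum I (r : seq I) (P : pred I) (f : I -> V -> R) x :
  (forall i, P i -> differentiable (f i) x) ->
  differentiable (fun z => \sum_(i <- r | P i) f i z) x.
Proof.
move=> fd; have -> : (fun z => \sum_(i <- r | P i) f i z) = \sum_(i <- r | P i) f i.
  by apply/funext => z; rewrite fct_sumE.
elim/big_ind : _ => [|h k hd kd|i Pi].
- exact: differentiable_cst.
- exact: differentiableD.
- exact: fd.
Qed.

Lemma differentiable_bigprod I (r : seq I) (P : pred I) (f : I -> V -> R) x :
  (forall i, P i -> differentiable (f i) x) ->
  differentiable (fun z => \prod_(i <- r | P i) f i z) x.
Proof.
move=> fd; elim: r => [|i r IH].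
  by under eq_fun do rewrite big_nil; exact: differentiable_cst.
case Pi: (P i); under eq_fun do rewrite big_cons Pi; last exact: IH.
exact: (differentiableM (fd i Pi) IH).
Qed.

Lemma differentiable_det m (F : V -> 'M[R]_m) x :
  (forall i j, differentiable (fun z => F z i j) x) ->
  differentiable (fun z => \det (F z)) x.
Proof.
move=> Fd; apply: differentiable_bigsum => s _.
apply: differentiableM; first exact: differentiable_cst.
apply: (@differentiable_bigprod _ _ _ (fun i z => F z i ((s : 'S_m) i))) => i _.
exact: Fd.
Qed.

(** The inverse is the adjugate divided by the determinant, hence rational in
the entries. *)
Lemma differentiable_invmx m (F : V -> 'M[R]_m) x k l :
  (\forall z \near x, F z \in unitmx) ->
  (forall i j, differentiable (fun z => F z i j) x) ->
  differentiable (fun z => invmx (F z) k l) x.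
Proof.
move=> Fu Fd.
(* [invmx] is the identity on singular matrices, so this holds only near [x] *)
apply: (@near_eq_differentiable _ _ _ (fun z => (\det (F z))^-1 * cofactor (F z) l k)).
  by apply: filterS Fu => z Fz; rewrite /invmx Fz !mxE.
apply: differentiableM.
  apply: differentiableV; first exact: differentiable_det.
  by have := nbhs_singleton Fu; rewrite unitmxE unitfE.
apply: differentiableM; first exact: differentiable_cst.
apply: differentiable_det => i j.
by under eq_fun do rewrite !mxE.
Qed.

End DiffInv.

Section Algebra.
Context {R : realType} {n : nat}.
Implicit Types (u v w x : 'rV[R]_n).

(** Turns the Killing equation, a family of equations indexed by (i, j), into one
about two constant vector fields, as the abstract argument needs it. *)
Lemma lie_algebra (A : 'M[R]_n) (d : 'I_n -> 'I_n -> 'I_n -> R)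
    (e : 'I_n -> 'I_n -> R) x u v :
  (forall i j, \sum_k (x 0 k * d k i j + A k j * e i k + A i k * e j k) = 0) ->
  trilin d x u v + bil A (\row_k \sum_i u 0 i * e i k) v +
    bil A u (\row_k \sum_j v 0 j * e j k) = 0.
Proof.
move=> lie.
transitivity (\sum_i \sum_j
   (\sum_k (x 0 k * d k i j + A k j * e i k + A i k * e j k)) * u 0 i * v 0 j); last first.
  by apply: big1 => i _; apply: big1 => j _; rewrite lie !mul0r.
have -> : trilin d x u v = \sum_i \sum_j (\sum_k x 0 k * d k i j) * u 0 i * v 0 j.
  rewrite /trilin exchange_big; apply: eq_bigr => i _; rewrite exchange_big.
  apply: eq_bigr => j _; rewrite !big_distrl; apply: eq_bigr => k _ /=; ring.
have -> : bil A (\row_k \sum_i u 0 i * e i k) v =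
    \sum_i \sum_j (\sum_k A k j * e i k) * u 0 i * v 0 j.
  rewrite bil_sum exchange_big [RHS]exchange_big; apply: eq_bigr => j _ /=.
  under eq_bigr do rewrite mxE big_distrr big_distrl /=.
  rewrite exchange_big; apply: eq_bigr => i _ /=.
  rewrite !big_distrl; apply: eq_bigr => k _ /=; ring.
have -> : bil A u (\row_k \sum_j v 0 j * e j k) =
    \sum_i \sum_j (\sum_k A i k * e j k) * u 0 i * v 0 j.
  rewrite bil_sum; apply: eq_bigr => i _ /=.
  under eq_bigr do rewrite mxE big_distrr /=.
  rewrite exchange_big; apply: eq_bigr => j _ /=.
  rewrite !big_distrl; apply: eq_bigr => k _ /=; ring.
rewrite -!big_split; apply: eq_bigr => i _; rewrite -!big_split.
by apply: eq_bigr => j _ /=; rewrite !big_split /= !mulrDl.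
Qed.

Lemma bil_bil_row (A : 'M[R]_n) (C : 'I_n -> 'M[R]_n) u v w :
  bil A u (\row_m bil (C m) v w) =
  \sum_i \sum_j \sum_k (\sum_m A i m * C m j k) * u 0 i * v 0 j * w 0 k.
Proof.
rewrite bil_sum; apply: eq_bigr => i _.
under eq_bigr do rewrite mxE bil_sum big_distrr /=.
rewrite exchange_big; apply: eq_bigr => j _ /=.
under eq_bigr do rewrite big_distrr /=.
rewrite exchange_big; apply: eq_bigr => k _ /=.
by rewrite !big_distrl; apply: eq_bigr => m _ /=; ring.
Qed.

(** The same passage to index-free form for the curvature. *)
Lemma riemann_algebra (C : 'I_n -> 'M[R]_n)
    (d : 'I_n -> 'I_n -> 'I_n -> R) (l : 'I_n) u v w :
  \sum_i \sum_j \sum_k (d i j k - d j i k +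
     \sum_m (C l i m * C m j k - C l j m * C m i k)) * u 0 i * v 0 j * w 0 k =
  trilin d u v w - trilin d v u w + bil (C l) u (\row_m bil (C m) v w)
   - bil (C l) v (\row_m bil (C m) u w).
Proof.
have -> : trilin d v u w = \sum_i \sum_j \sum_k d j i k * u 0 i * v 0 j * w 0 k.
  by rewrite /trilin exchange_big; do 3!(apply: eq_bigr => ? _); ring.
rewrite !bil_bil_row.
have -> : \sum_i \sum_j \sum_k (\sum_m C l i m * C m j k) * v 0 i * u 0 j * w 0 k
   = \sum_i \sum_j \sum_k (\sum_m C l j m * C m i k) * u 0 i * v 0 j * w 0 k.
  by rewrite exchange_big; do 3!(apply: eq_bigr => ? _); ring.
rewrite /trilin -sumrB -big_split -sumrB; apply: eq_bigr => i _.
rewrite -sumrB -big_split -sumrB; apply: eq_bigr => j _.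
rewrite -sumrB -big_split -sumrB; apply: eq_bigr => k _ /=.
by rewrite sumrB; ring.
Qed.

End Algebra.

Section LocalKilling.
Context {R : realType} {n : nat} {M : smooth_manifold R n}.
Variables (g : metric M) (phi : chart R n M) (X : vfield M).
Hypothesis aphi : atlas phi.
Hypothesis X_smooth : smooth_vfield X.
Local Notation G := (gram g phi).
Local Notation Gam := (christoffel_form g phi).
Local Notation xi := (field_coord phi X).
Implicit Types (y u v w z : 'rV[R]_n).

(** Only first derivatives of the Christoffel symbols enter the curvature, so
the metric is differentiated twice. *)
Lemma christoffel_diff k i j y : cimg phi y ->
  differentiable (christoffel g phi k i j) y.
Proof.
move=> yi.
pose f z := 2^-1 * \sum_l invmx (G z) k l *
    ('D_(delta_mx 0 i) G z j l + 'D_(delta_mx 0 j) G z i l - 'D_(delta_mx 0 l) G z i j).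
apply: (@near_eq_differentiable _ _ _ f).
  apply: filterS (near_cimg yi) => z zi.
  rewrite /f /christoffel; congr (_ * _); apply: eq_bigr => l _.
  congr (_ * (_ + _ - _)); apply: esym; exact: partial_gram.
have dd a b c : differentiable (fun z => 'D_(delta_mx 0 a) G z b c) y.
  exact: differentiable_entry (dgram_diff g aphi (delta_mx 0 a) yi).
apply: differentiableM; first exact: differentiable_cst.
apply: differentiable_bigsum => l _; apply: differentiableM.
  apply: differentiable_invmx.
    by apply: filterS (near_cimg yi) => z; exact: gram_unit.
  by move=> a b; exact: differentiable_entry (gram_diff g aphi yi).
by apply: differentiableB => //; exact: differentiableD.
Qed.

Definition dchristoffel_form y u v w : 'rV[R]_n :=
  \row_k bil (\matrix_(i, j) 'D_u (christoffel g phi k i j) y) v w.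
Local Notation dGam := dchristoffel_form.

Lemma is_derive_christoffel_form y u (f h : 'rV[R]_n -> 'rV[R]_n) (df dh : 'rV[R]_n) :
  cimg phi y -> is_derive y u f df -> is_derive y u h dh ->
  is_derive y u (fun z => Gam z (f z) (h z))
    (dGam y u (f y) (h y) + Gam y df (h y) + Gam y (f y) dh).
Proof.
move=> yi fd hd; apply: is_derive_mx => a k.
under eq_fun do rewrite mxE.
apply: is_derive_eq.
  apply: is_derive_bil fd hd.
  apply: (@is_derive_mx _ _ _ _ _ _ _
    (\matrix_(i, j) 'D_u (christoffel g phi k i j) y)) => i j.
  rewrite mxE; under eq_fun do rewrite mxE.
  exact: is_derive_diff (christoffel_diff k i j yi).
by rewrite !mxE.
Qed.

Lemma is_derive_metric y u (f h : 'rV[R]_n -> 'rV[R]_n) (df dh : 'rV[R]_n) :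
  cimg phi y -> is_derive y u f df -> is_derive y u h dh ->
  is_derive y u (fun z => bil (G z) (f z) (h z))
    (bil (G y) (df + Gam y u (f y)) (h y) + bil (G y) (f y) (dh + Gam y u (h y))).
Proof.
move=> yi fd hd.
apply: is_derive_eq (is_derive_bil (is_derive_diff u (gram_diff g aphi yi)) fd hd) _.
rewrite (metric_compat g aphi u (f y) (h y) yi) bilDl bilDr.
by rewrite [RHS]addrACA [RHS]addrC addrA.
Qed.

(** By compatibility both functions are first derivatives of the same metric
coefficient. *)
Lemma metric_schwarz y u v w (t : 'rV[R]_n) : cimg phi y ->
  'D_u (fun z => bil (G z) (Gam z v w) t + bil (G z) w (Gam z v t)) y =
  'D_v (fun z => bil (G z) (Gam z u w) t + bil (G z) w (Gam z u t)) y.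
Proof.
move=> yi; have der a b :
    'D_a (fun z => bil (G z) (Gam z b w) t + bil (G z) w (Gam z b t)) y =
    bil ('D_a ('D_b G) y) w t.
  apply: etrans _ (@derive_val _ _ _ _ _ _ _
    (is_derive_bil_cst w t (is_derive_diff a (dgram_diff g aphi b yi)))).
  apply: near_eq_derive; apply: filterS (near_cimg yi) => z zi.
  exact/esym/metric_compat.
apply: etrans (der u v) _; apply: etrans _ (esym (der v u)).
exact: (congr1 (fun C => bil C w t)
  (Ck_on_schwarz v u (near_cimg yi) (gram_C2 g aphi))).
Qed.

Lemma field_C2 : Ck_on 2 (cimg phi) xi.
Proof. exact: X_smooth. Qed.

Lemma field_diff y : cimg phi y -> differentiable xi y.
Proof. exact: field_C2.1. Qed.

Lemma dfield_diff y u : cimg phi y -> differentiable ('D_u xi) y.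
Proof. exact: (field_C2.2 u).1. Qed.

Lemma dfield_entry y u : cimg phi y ->
  'D_u xi y = \row_k \sum_i u 0 i * partial i (fun z => xi z 0 k) y.
Proof.
move=> yi; apply/rowP => k; rewrite mxE (derive_partials u (field_diff yi)) summxE.
apply: eq_bigr => i _; rewrite mxE; congr (_ * _); apply: esym.
have := is_derive_entry 0 k (is_derive_diff (delta_mx 0 i) (field_diff yi)).
by move=> /@derive_val.
Qed.

Lemma killing_form y u v : lie_metric g X phi y = 0 -> cimg phi y ->
  'D_(xi y) (fun z => bil (G z) u v) y + bil (G y) ('D_u xi y) v +
    bil (G y) u ('D_v xi y) = 0.
Proof.
move=> lie yi; rewrite (dfield_entry u yi) (dfield_entry v yi).
have -> : 'D_(xi y) (fun z => bil (G z) u v) y =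
    trilin (fun i j l => partial i (fun z => G z j l) y) (xi y) u v.
  apply: etrans _ (bil_dgram g aphi (xi y) u v yi).
  exact: (@derive_val _ _ _ _ _ _ _
    (is_derive_bil_cst u v (is_derive_diff (xi y) (gram_diff g aphi yi)))).
apply: lie_algebra => i j.
by have := congr1 (fun A : 'M[R]_n => A i j) lie; rewrite !mxE.
Qed.

Lemma curvature_form y u v w : cimg phi y ->
  \row_l \sum_i \sum_j \sum_k
    riemann_coef g phi l k i j y * u 0 i * v 0 j * w 0 k =
  riem Gam dGam y u v w.
Proof.
move=> yi; have dG a b c l : bil (\matrix_(i, j) 'D_a (christoffel g phi l i j) y) b c
    = trilin (fun i j k => partial i (christoffel g phi l j k) y) a b c.
  rewrite bil_sum /trilin [RHS]exchange_big; apply: eq_bigr => j _ /=.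
  rewrite [RHS]exchange_big; apply: eq_bigr => k _ /=.
  rewrite mxE (derive_partials a (christoffel_diff l j k yi)) !big_distrl.
  by apply: eq_bigr => i _ /=; rewrite [X in X * _ * _]mulrC.
apply/rowP => l; rewrite mxE.
have rE : riem Gam dGam y u v w 0 l =
    dGam y u v w 0 l - dGam y v u w 0 l + Gam y u (Gam y v w) 0 l
    - Gam y v (Gam y u w) 0 l.
  have ent (a b c d : 'rV[R]_n) :
      (a - b + c - d) 0 l = a 0 l - b 0 l + c 0 l - d 0 l by rewrite !mxE.
  exact: ent.
have dGE a b c : dGam y a b c 0 l =
    trilin (fun i j k => partial i (christoffel g phi l j k) y) a b c.
  by rewrite mxE; exact: dG.
apply: etrans _ (esym rE); rewrite !dGE.
apply: etrans _ (etrans (riemann_algebra (fun m => \matrix_(i, j) christoffel g phi m i j y)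
  (fun i j k => partial i (christoffel g phi l j k) y) l u v w) _).
  do 3!(apply: eq_bigr => ? _); congr (_ * _ * _ * _).
  by congr (_ + _); apply: eq_bigr => m _; rewrite !mxE.
by congr (_ + _ - _); rewrite mxE.
Qed.

End LocalKilling.

(** * The flow in charts *)

(** Here [J] is the differential of an isometry, acting on row vectors, and [c]
and [c'] represent corresponding linear forms.  An isometry of nondegenerate
forms is invertible, so [c'] is the image of [c]. *)
Lemma isometry_adjoint (R : realType) n (G G' J : 'M[R]_n) (c c' : 'rV[R]_n) :
  (forall u, bil G u u = 0 -> u = 0) -> (forall u, bil G' u u = 0 -> u = 0) ->
  (forall a b, bil G' (a *m J) (b *m J) = bil G a b) ->
  (forall b, bil G' c' (b *m J) = bil G c b) -> bil G' c' c' = bil G c c.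
Proof.
move=> Gn Gn' iso adj.
have Ju : J \in unitmx.
  rewrite -row_free_unit -kermx_eq0; apply/rowV0P => v /sub_kermxP vJ.
  by apply: Gn; rewrite -iso vJ bil0l.
have <- : c *m J = c'.
  apply/subr0_eq/Gn'; rewrite -{2}(mulmxKV Ju (c *m J - c')).
  by rewrite bilDl bilNl iso adj subrr.
exact: iso.
Qed.

Lemma continuous_pair_at (S T U : topologicalType) (f : S -> T) (h : S -> U) x :
  {for x, continuous f} -> {for x, continuous h} ->
  {for x, continuous (fun z => (f z, h z))}.
Proof. by move=> fc hc; exact: (cvg_pair fc hc). Qed.

Section TangentMaps.
Context {R : realType} {n : nat} {M : smooth_manifold R n}.
Implicit Types (phi psi : chart R n M) (p : M).

Lemma is_derive_velocity (c : R -> M) psi t : atlas psi -> cdom psi (c t) ->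
  {for t, continuous c} ->
  derivable (fun s => cfun (chart_at (c t)) (c s)) t 1 ->
  is_derive t 1 (fun s => cfun psi (c s)) (tcoord psi (velocity c t)).
Proof.
move=> ap pc cc cd.
have pc' := cdom_chart_at (c t); have ac := atlas_chart_at (c t).
set chi := chart_at (c t) in cd pc' ac *.
have td := differentiable_trans ac ap pc' pc.
have cdiff : differentiable (fun s => cfun chi (c s)) t by apply/derivable1_diffP.
have := is_derive_comp (1 : R) cdiff td.
have -> : 'D_('D_1 (fun s => cfun chi (c s)) t) (cfun psi \o cinv chi) (cfun chi (c t))
   = tcoord psi (velocity c t).
  apply: etrans (deriveE _ td) _.
  by rewrite /tcoord /velocity derive1E.
apply: near_eq_is_derive.
have ncd : \forall s \near t, cdom chi (c s) by exact: (cc _ (near_cdom pc')).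
by apply: filterS ncd => s sd /=; rewrite cfunK.
Qed.

Lemma tcoord_dmap (f : M -> M) phi psi p (v : tangent p) :
  atlas phi -> atlas psi -> cdom phi p -> cdom psi (f p) ->
  {for p, continuous f} ->
  (forall a b : chart R n M, atlas a -> atlas b -> cdom a p -> cdom b (f p) ->
    differentiable (cfun b \o f \o cinv a) (cfun a p)) ->
  tcoord psi (dmap f v) = 'D_(tcoord phi v) (cfun psi \o f \o cinv phi) (cfun phi p).
Proof.
move=> ap aq pp pq fc fd.
have pc := cdom_chart_at p; have ac := atlas_chart_at p.
have pc' := cdom_chart_at (f p); have ac' := atlas_chart_at (f p).
have d1 := fd _ _ ac ac' pc pc'.
have d2 := fd _ _ ap aq pp pq.
have td := differentiable_trans ac' aq pc' pq.
have xE : (cfun (chart_at (f p)) \o f \o cinv (chart_at p)) (cfun (chart_at p) p)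
    = cfun (chart_at (f p)) (f p) by rewrite /= cfunK.
have td' := td; rewrite -xE in td'.
have e1 := diff_compE v xE d1 td.
have nE : \forall y \near cfun (chart_at p) p,
   ((cfun psi \o cinv (chart_at (f p))) \o
    (cfun (chart_at (f p)) \o f \o cinv (chart_at p))) y =
   ((cfun psi \o f) \o cinv (chart_at p)) y.
  apply: filterS (near_cinv pc (fc _ (near_cdom pc'))) => y yd /=.
  by rewrite cfunK.
have e2 := near_eq_diff v nE (differentiable_comp d1 td').
have [_ e3] := diff_chart_change ac ap pc pp d2.
apply: etrans (esym e1) _; apply: etrans (esym e2) _.
by apply: etrans (e3 v) _; apply: esym; exact: deriveE.
Qed.

End TangentMaps.

Section Flow.
Context {R : realType} {n : nat} {M : smooth_manifold R n}.
Variables (g : metric M) (X : vfield M) (gamma : R -> M -> M).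
Hypothesis motions : one_parameter_group_of_motions g gamma.
Hypothesis gen : generates X gamma.
Implicit Types (phi psi : chart R n M) (p : M) (a b y : 'rV[R]_n).
Local Notation E := (R^o * 'rV[R]_n)%type.

Let gamma0 : forall p, gamma 0 p = p. Proof. by case: motions. Qed.
Let gammaD : forall s t p, gamma (s + t) p = gamma s (gamma t p).
Proof. by case: motions. Qed.

(** The flow read in a chart at the source and a chart at the target, jointly
in time and position. *)
Definition flow_coord phi psi (z : E) : 'rV[R]_n := cfun psi (gamma z.1 (cinv phi z.2)).

Definition flow_dom phi psi : set E :=
  [set z | cimg phi z.2 /\ cdom psi (gamma z.1 (cinv phi z.2))].

Lemma flow_continuous phi (z : E) : atlas phi -> cimg phi z.2 ->
  {for z, continuous (fun z : E => gamma z.1 (cinv phi z.2))}.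
Proof. by move=> ap zi; case: motions => _ _ sm _; have [+ _] := sm phi ap; apply. Qed.

Lemma near_flow_dom phi psi (z : E) : atlas phi -> flow_dom phi psi z ->
  \forall z' \near z, flow_dom phi psi z'.
Proof.
move=> ap [zi zd].
have n1 : \forall z' \near z, cimg phi z'.2 by exact: (cvg_snd (near_cimg zi)).
have n2 := flow_continuous ap zi (near_cdom zd).
by near=> z'; split; near: z'.
Unshelve. all: by end_near. Qed.

Lemma flow_smooth phi psi : atlas phi -> atlas psi ->
  Ck_on 2 (flow_dom phi psi) (flow_coord phi psi).
Proof.
by move=> ap aq; case: motions => _ _ sm _; have [_ h] := sm phi ap; exact: (h psi aq 2%N).
Qed.

Lemma flow_diff phi psi z : atlas phi -> atlas psi -> flow_dom phi psi z ->
  differentiable (flow_coord phi psi) z.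
Proof. by move=> ap aq; apply: (flow_smooth ap aq).1. Qed.

Lemma dflow_diff phi psi z (d : E) : atlas phi -> atlas psi -> flow_dom phi psi z ->
  differentiable ('D_d (flow_coord phi psi)) z.
Proof. by move=> ap aq; apply: ((flow_smooth ap aq).2 d).1. Qed.

Definition time_dir : E := (1 : R^o, 0 : 'rV[R]_n).
Definition space_dir a : E := (0 : R^o, a).

Lemma is_derive_time (W : normedModType R) (f : E -> W) (t : R) y :
  differentiable f (t : R^o, y) ->
  is_derive t 1 (fun s : R => f (s : R^o, y)) ('D_time_dir f (t : R^o, y)).
Proof.
move=> fd; have sE (s : R) : (0 : R^o, y) + s *: time_dir = (s : R^o, y) :> E.
  by apply: injective_projections; rewrite /= ?add0r ?scaler0 ?addr0 // [s *: _]mulr1.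
have -> : (fun s : R => f (s : R^o, y)) = (fun s : R => f ((0 : R^o, y) + s *: time_dir)).
  by apply/funext => s; rewrite sE.
by apply: is_derive_line; rewrite sE; exact: is_derive_diff.
Qed.

Lemma slice_diff (W : normedModType R) (f : E -> W) (t : R) y :
  differentiable f (t : R^o, y) -> differentiable (fun z => f (t : R^o, z)) y.
Proof.
move=> fd.
have pd : differentiable (fun z : 'rV[R]_n => (t : R^o, z)) y.
  by apply: differentiable_pair.
exact: (differentiable_comp pd fd).
Qed.

Lemma derive_space (W : normedModType R) (f : E -> W) (t : R) y a :
  'D_a (fun z => f (t : R^o, z)) y = 'D_(space_dir a) f (t : R^o, y).
Proof.
have key : (fun h : R => h^-1 *: (((fun z => f (t : R^o, z)) \o shift y) (h *: a) -
      f (t : R^o, y))) =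
    (fun h : R => h^-1 *: ((f \o shift (t : R^o, y)) (h *: space_dir a) - f (t : R^o, y))).
  apply/funext => h /=; congr (_ *: (f _ - _)).
  by apply: injective_projections => //=; rewrite scaler0 add0r.
by rewrite /derive key.
Qed.

Lemma is_derive_flow_time phi psi (t : R) y : atlas phi -> atlas psi ->
  flow_dom phi psi (t : R^o, y) ->
  is_derive t 1 (fun s : R => flow_coord phi psi (s : R^o, y))
    (field_coord psi X (flow_coord phi psi (t : R^o, y))).
Proof.
move=> ap aq zd; have [yi cd] := zd.
pose c s := gamma s (cinv phi y).
have cc : {for t, continuous c}.
  have h := flow_continuous (z := (t : R^o, y)) ap yi.
  have pc : {for t, continuous (fun s : R => (s : R^o, y) : E)}.
    exact: continuous_pair_at cvg_id (@cst_continuous _ _ y t).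
  exact: (continuous_comp pc h).
have zd' : flow_dom phi (chart_at (c t)) (t : R^o, y).
  by split => //; exact: cdom_chart_at.
have dc : derivable (fun s => cfun (chart_at (c t)) (c s)) t 1.
  by have [] := is_derive_time (flow_diff ap (atlas_chart_at _) zd').
have := is_derive_velocity aq cd cc dc.
by rewrite (gen (cinv phi y) t) -field_coord_cfun.
Qed.

(** The field is the velocity of the flow at every time: no passage to time 0
through the group law is involved. *)
Lemma derive_flow_time phi psi (t : R) y : atlas phi -> atlas psi ->
  flow_dom phi psi (t : R^o, y) ->
  'D_time_dir (flow_coord phi psi) (t : R^o, y) =
  field_coord psi X (flow_coord phi psi (t : R^o, y)).
Proof.
move=> ap aq zd; have [_ <-] := is_derive_time (flow_diff ap aq zd).
by have [_ ->] := is_derive_flow_time ap aq zd.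
Qed.

Lemma gamma_continuous t p : {for p, continuous (gamma t)}.
Proof.
have ac := atlas_chart_at p; have pc := cdom_chart_at p.
have h := flow_continuous (z := (t : R^o, cfun (chart_at p) p)) ac (cimg_cfun pc).
have h2 : {for p, continuous (fun q => gamma t (cinv (chart_at p) (cfun (chart_at p) q)))}.
  have pr : {for p, continuous (fun q => (t : R^o, cfun (chart_at p) q) : E)}.
    exact: continuous_pair_at (@cst_continuous _ _ _ p) (cfun_continuous pc).
  exact: (continuous_comp pr h).
have nE : \forall q \near p, gamma t (cinv (chart_at p) (cfun (chart_at p) q)) = gamma t q.
  by apply: filterS (near_cdom pc) => q qd; rewrite cfunK.
have h3 : gamma t (cinv (chart_at p) (cfun (chart_at p) q)) @[q --> p] --> gamma t p.
  by have e := nbhs_singleton nE; rewrite -[X in _ --> X]e; exact: h2.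
exact: cvg_trans (near_eq_cvg nE) h3.
Qed.

(** Differentials of the motions are spatial derivatives of [flow_coord]; this
is how the field Y enters the computations in charts. *)
Lemma tcoord_dgamma t phi psi p (v : tangent p) :
  atlas phi -> atlas psi -> cdom phi p -> cdom psi (gamma t p) ->
  tcoord psi (dmap (gamma t) v) =
  'D_(space_dir (tcoord phi v)) (flow_coord phi psi) (t : R^o, cfun phi p).
Proof.
move=> ap aq pp pq; rewrite -derive_space.
apply: tcoord_dmap => //; first exact: gamma_continuous.
move=> a b aa ab pa pb.
have zd : flow_dom a b (t : R^o, cfun a p).
  by split; [exact: cimg_cfun|rewrite /= cfunK].
exact: slice_diff (flow_diff aa ab zd).
Qed.

(** Differentiate gamma_(t+s) = gamma_t o gamma_s with respect to [s] at 0. *)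
Lemma flow_push_field phi psi (t : R) y : atlas phi -> atlas psi ->
  flow_dom phi psi (t : R^o, y) ->
  'D_(space_dir (field_coord phi X y)) (flow_coord phi psi) (t : R^o, y) =
  field_coord psi X (flow_coord phi psi (t : R^o, y)).
Proof.
move=> ap aq zd; have [yi cd] := zd; rewrite -derive_space.
have z0 : flow_dom phi phi (0 : R^o, y).
  by split => //=; rewrite gamma0; exact: cdom_cinv.
have f0 : flow_coord phi phi (0 : R^o, y) = y by rewrite /flow_coord /= gamma0 cinvK.
have d1 := is_derive_flow_time ap ap z0; rewrite f0 in d1.
have [dd1 e1] := d1.
have diff1 : differentiable (fun s : R => flow_coord phi phi (s : R^o, y)) 0.
  by apply/derivable1_diffP.
have diff2 : differentiable (fun z => flow_coord phi psi (t : R^o, z))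
    (flow_coord phi phi (0 : R^o, y)).
  by rewrite f0; exact: slice_diff (flow_diff ap aq zd).
have [_ e2] := is_derive_comp (1 : R) diff1 diff2.
rewrite e1 f0 in e2; rewrite -e2.
have [_ e3] := is_derive_flow_time ap aq zd; rewrite -e3.
have -> : 'D_1 (fun s : R => flow_coord phi psi (s : R^o, y)) t =
    'D_1 (fun s : R => flow_coord phi psi ((s + t) : R^o, y)) 0.
  (* move the base point of the time derivative from [t] to 0 *)
  have key : (fun h : R => h^-1 *:
        (((fun s : R => flow_coord phi psi (s : R^o, y)) \o shift t) (h *: (1 : R)) -
          flow_coord phi psi (t : R^o, y))) =
      (fun h : R => h^-1 *:
        (((fun s : R => flow_coord phi psi ((s + t) : R^o, y)) \o shift 0) (h *: (1 : R)) -
          flow_coord phi psi ((0 + t) : R^o, y))).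
    by apply/funext => h /=; rewrite addr0 add0r.
  by rewrite /derive key.
apply: near_eq_derive.
have ncont : {for 0, continuous (fun s : R => (s : R^o, y) : E)}.
  exact: continuous_pair_at cvg_id (@cst_continuous _ _ y _).
have nz : \forall s \near (0 : R), flow_dom phi phi (s : R^o, y).
  exact: ncont _ (near_flow_dom ap z0).
apply: filterS nz => s [_ sd].
by rewrite /flow_coord /= (cfunK sd) -gammaD addrC.
Qed.

Lemma flow_isometry phi psi (t : R) y a b : atlas phi -> atlas psi ->
  flow_dom phi psi (t : R^o, y) ->
  bil (gram g psi (flow_coord phi psi (t : R^o, y)))
    ('D_(space_dir a) (flow_coord phi psi) (t : R^o, y))
    ('D_(space_dir b) (flow_coord phi psi) (t : R^o, y)) =
  bil (gram g phi y) a b.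
Proof.
move=> ap aq [/= [p pp <-] pq0].
have pq : cdom psi (gamma t p) by move: pq0; rewrite /= cfunK.
have tv c : 'D_(space_dir c) (flow_coord phi psi) (t : R^o, cfun phi p) =
    tcoord psi (dmap (gamma t) (tvect phi p c)).
  by rewrite (tcoord_dgamma _ ap aq pp pq) tvectK.
have -> : flow_coord phi psi (t : R^o, cfun phi p) = cfun psi (gamma t p).
  by rewrite /flow_coord /= cfunK.
apply: etrans (congr2 (bil _) (tv a) (tv b)) _.
apply: etrans (esym (inner_gram g _ _ aq pq)) _.
have iso : forall s q (u v : tangent q),
    g (gamma s q) (dmap (gamma s) u) (dmap (gamma s) v) = g q u v by case: motions.
apply: etrans (iso _ _ _ _) _; apply: etrans (inner_gram g _ _ ap pp) _.
exact: (congr2 (bil (gram g phi (cfun phi p))) (tvectK a ap pp) (tvectK b ap pp)).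
Qed.

End Flow.

(** * The covariant derivative of the field and its invariance *)

Section KillingChart.
Context {R : realType} {n : nat} {M : smooth_manifold R n}.
Variables (g : metric M) (X : vfield M).
Hypothesis X_killing : killing g X.
Implicit Types (phi psi : chart R n M) (y a b : 'rV[R]_n).

Definition cov_chart phi y a : 'rV[R]_n :=
  cov_field (christoffel_form g phi) (field_coord phi X) y a.

Lemma cov_chart_skew phi y a b : atlas phi -> cimg phi y ->
  bil (gram g phi y) (cov_chart phi y a) b =
  - bil (gram g phi y) a (cov_chart phi y b).
Proof.
case: X_killing => sm lie ap yi.
exact: (@cov_field_skew _ _ (cimg phi) (fun y u v => bil (gram g phi y) u v)
  (christoffel_form g phi) (field_coord phi X)
  (bil_gramC g phi) (fun y => bilDl (gram g phi y)) (christoffel_formC g phi)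
  (is_derive_metric g ap)
  (fun y u v yi => killing_form ap sm u v (lie phi ap y yi) yi)).
Qed.

(** The factor 2 comes from skewness.  The left-hand side involves only the
metric and the field, which makes the operator comparable between charts. *)
Lemma cov_chart_exterior phi y a b : atlas phi -> cimg phi y ->
  'D_a (fun z => bil (gram g phi z) b (field_coord phi X z)) y -
  'D_b (fun z => bil (gram g phi z) a (field_coord phi X z)) y =
  2 * bil (gram g phi y) (cov_chart phi y a) b.
Proof.
case: X_killing => sm lie ap yi.
have h := @dual_form_exterior _ _ (cimg phi) (fun y u v => bil (gram g phi y) u v)
  (christoffel_form g phi) (field_coord phi X) (christoffel_formC g phi)
  (is_derive_metric g ap) (field_diff ap sm) y a b yi.
apply: etrans h _.
have lin (p q r : R) : p = r -> q = - r -> p - q = 2 * r by move=> -> ->; ring.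
apply: lin; first exact: bil_gramC.
by apply: esym; rewrite cov_chart_skew // opprK.
Qed.

Lemma cov_chart_curvature phi y a : atlas phi -> cimg phi y -> unit_vfield g X ->
  bil (gram g phi y)
    (riem (christoffel_form g phi) (dchristoffel_form g phi) y (field_coord phi X y) a a)
    (field_coord phi X y) =
  bil (gram g phi y) (cov_chart phi y a) (cov_chart phi y a).
Proof.
case: X_killing => sm lie ap yi Xu.
have un z : cimg phi z ->
    bil (gram g phi z) (field_coord phi X z) (field_coord phi X z) = 1.
  move=> [p pp <-]; apply: etrans (Xu p); rewrite (inner_gram g _ _ ap pp).
  by rewrite (field_coord_cfun X pp).
exact: (@curvature_cov_field _ _ (cimg phi) (fun y u v => bil (gram g phi y) u v)
  (christoffel_form g phi) (dchristoffel_form g phi) (field_coord phi X)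
  (fun y => @near_cimg _ _ _ phi y)
  (bil_gramC g phi) (fun y => bilDl (gram g phi y)) (fun y => bilNl (gram g phi y))
  (fun y u => gram_nondeg ap) (christoffel_formC g phi) (christoffel_formDl g phi)
  (is_derive_metric g ap)
  (is_derive_christoffel_form g ap)
  (metric_schwarz g ap) (field_diff ap sm) (fun y u => dfield_diff ap sm u)
  (fun y u v yi => Ck_on_schwarz v u (near_cimg yi) (field_C2 ap sm))
  (fun y u v yi => killing_form ap sm u v (lie phi ap y yi) yi) un y a yi).
Qed.

End KillingChart.

Section KillingFlow.
Context {R : realType} {n : nat} {M : smooth_manifold R n}.
Variables (g : metric M) (X : vfield M) (gamma : R -> M -> M).
Hypothesis X_killing : killing g X.
Hypothesis motions : one_parameter_group_of_motions g gamma.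
Hypothesis gen : generates X gamma.
Implicit Types (phi psi : chart R n M) (y a b : 'rV[R]_n).
Local Notation FL := (flow_coord gamma).

Lemma dgamma_field t p : dmap (gamma t) (X p) = X (gamma t p).
Proof.
have ap := atlas_chart_at p; have pp := cdom_chart_at p.
have aq := atlas_chart_at (gamma t p); have pq := cdom_chart_at (gamma t p).
have zd : flow_dom gamma (chart_at p) (chart_at (gamma t p)) (t : R^o, cfun (chart_at p) p).
  by split; [exact: cimg_cfun|rewrite /= cfunK].
have fE : FL (chart_at p) (chart_at (gamma t p)) (t : R^o, cfun (chart_at p) p)
    = cfun (chart_at (gamma t p)) (gamma t p) by rewrite /flow_coord /= cfunK.
have e := flow_push_field motions gen ap aq zd.
rewrite fE (field_coord_cfun X pp) (field_coord_cfun X pq) in e.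
apply: etrans (esym (tcoord_chart_at (dmap (gamma t) (X p)))) _.
apply: etrans (tcoord_dgamma motions (X p) ap aq pp pq) _.
exact: etrans e (tcoord_chart_at (X (gamma t p))).
Qed.

(** Pull-back of the 1-form g(., X) by the flow, differentiated: the last term
contains the second derivative of the flow, symmetric in [a] and [b], and
disappears when [a] and [b] are exchanged and the results subtracted. *)
Lemma flow_dual_form phi psi (t : R) y a b : atlas phi -> atlas psi ->
  flow_dom gamma phi psi (t : R^o, y) ->
  let F z := FL phi psi (t : R^o, z) in
  'D_a (fun z => bil (gram g phi z) b (field_coord phi X z)) y =
  'D_('D_a F y) (fun z => bil (gram g psi z) ('D_b F y) (field_coord psi X z)) (F y) +
  bil (gram g psi (F y)) ('D_(space_dir a) ('D_(space_dir b) (FL phi psi)) (t : R^o, y))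
     (field_coord psi X (F y)).
Proof.
move=> ap aq zd F; have [yi yd] := zd; have [sm _] := X_killing.
have Fi : cimg psi (F y) by exact: cimg_cfun.
have Fd : differentiable F y by exact: slice_diff (flow_diff motions ap aq zd).
have nd : \forall z \near y, flow_dom gamma phi psi (t : R^o, z).
  have sc : {for y, continuous (fun z : 'rV[R]_n => (t : R^o, z) : R^o * 'rV[R]_n)}.
    exact: continuous_pair_at (@cst_continuous _ _ _ y) cvg_id.
  exact: sc _ (near_flow_dom motions ap zd).
pose Db z := 'D_(space_dir b) (FL phi psi) (t : R^o, z).
have nE : \forall z \near y,
    bil (gram g psi (F z)) (Db z) (field_coord psi X (F z)) =
    bil (gram g phi z) b (field_coord phi X z).
  apply: filterS nd => z zz; have e := flow_push_field motions gen ap aq zz.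
  apply: etrans (congr1 (bil (gram g psi (F z)) (Db z)) (esym e)) _.
  exact: flow_isometry.
have Dbd : differentiable Db y.
  exact: (slice_diff (dflow_diff motions (space_dir b) ap aq zd)).
have dDb : is_derive y a Db ('D_(space_dir a) ('D_(space_dir b) (FL phi psi)) (t : R^o, y)).
  by rewrite -derive_space; exact: is_derive_diff.
have gd := is_derive_comp a Fd (gram_diff g aq Fi).
have xd := is_derive_comp a Fd (field_diff aq sm Fi).
have [_ e1] := is_derive_bil gd dDb xd.
have [_ e2] := is_derive_bil (is_derive_diff ('D_a F y) (gram_diff g aq Fi))
  (is_derive_cst ('D_b F y) (F y) ('D_a F y))
  (is_derive_diff ('D_a F y) (field_diff aq sm Fi)).
have DbE : Db y = 'D_b F y by rewrite /Db -derive_space.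
apply: etrans (esym (near_eq_derive a nE)) _.
apply: etrans e1 _; rewrite DbE.
apply: etrans _ (congr1 (fun r => r + _) (esym e2)).
by rewrite bil0l addr0 addrAC.
Qed.

(** The flow preserves the metric and the exterior derivative of g(., X), hence
the operator that represents the latter by means of the former. *)
Lemma flow_cov_norm phi psi (t : R) y a : atlas phi -> atlas psi ->
  flow_dom gamma phi psi (t : R^o, y) ->
  let y' := FL phi psi (t : R^o, y) in
  let a' := 'D_(space_dir a) (FL phi psi) (t : R^o, y) in
  bil (gram g psi y') (cov_chart g X psi y' a') (cov_chart g X psi y' a') =
  bil (gram g phi y) (cov_chart g X phi y a) (cov_chart g X phi y a).
Proof.
move=> ap aq zd y' a'; have [yi yd] := zd.
have yi' : cimg psi y' by exact: cimg_cfun.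
pose F z := FL phi psi (t : R^o, z).
have Fd : differentiable F y by exact: slice_diff (flow_diff motions ap aq zd).
have JE c : 'D_(space_dir c) (FL phi psi) (t : R^o, y) = c *m jacobian F y.
  by rewrite -derive_space; exact: deriveEjacobian.
apply: (@isometry_adjoint _ _ _ _ (jacobian F y)).
- by move=> u; exact: gram_nondeg.
- by move=> u; exact: gram_nondeg.
- by move=> c d; rewrite -!JE; exact: flow_isometry.
- move=> b; rewrite -JE; apply: (@mulfI _ 2); first by rewrite pnatr_eq0.
  apply: etrans (esym (cov_chart_exterior X_killing _ _ aq yi')) _.
  apply: etrans _ (cov_chart_exterior X_killing a b ap yi).
  have f1 := flow_dual_form a b ap aq zd.
  have f2 := flow_dual_form b a ap aq zd.
  cbv zeta in f1, f2; rewrite !derive_space in f1 f2.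
  have sw := Ck_on_schwarz (space_dir b) (space_dir a) (near_flow_dom motions ap zd)
    (flow_smooth motions ap aq).
  have lin (p q r s u v : R) : p = r + u -> q = s + v -> u = v -> r - s = p - q.
    by move=> -> -> ->; ring.
  apply: lin f1 f2 _.
  exact: (congr1 (fun c => bil (gram g psi y') c (field_coord psi X y')) sw).
Qed.

(** The time derivative of Y is a mixed second derivative of the flow.
Exchanging the derivatives and using the flow equation gives the derivative of
the field along Y; the Christoffel terms agree by symmetry. *)
Lemma cov_along_flow (x : M) (w : tangent x) (s : R) :
  let Y := fun s : R => dmap (gamma s) w : tangent (gamma s x) in
  let psi := chart_at (gamma s x) in
  cov_along g Y s = cov_chart g X psi (cfun psi (gamma s x)) (Y s).
Proof.
move=> Y psi.
have ap := atlas_chart_at x; have pp := cdom_chart_at x.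
have aq : atlas psi := atlas_chart_at (gamma s x).
have pq : cdom psi (gamma s x) := cdom_chart_at (gamma s x).
have [sm _] := X_killing.
set phi := chart_at x in ap pp.
pose y := cfun phi x.
have zd : flow_dom gamma phi psi (s : R^o, y).
  by split; [exact: cimg_cfun|rewrite /= cfunK].
have HE : FL phi psi (s : R^o, y) = cfun psi (gamma s x) by rewrite /flow_coord /= cfunK.
have Fi : cimg psi (FL phi psi (s : R^o, y)) by exact: cimg_cfun zd.2.
have tw : tcoord phi w = w := tcoord_chart_at w.
have nd : \forall t \near s, flow_dom gamma phi psi (t : R^o, y).
  have sc : {for s, continuous (fun t : R => (t : R^o, y) : R^o * 'rV[R]_n)}.
    exact: continuous_pair_at cvg_id (@cst_continuous _ _ _ s).
  exact: sc _ (near_flow_dom motions ap zd).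
have YE t : flow_dom gamma phi psi (t : R^o, y) ->
    tcoord psi (Y t) = 'D_(space_dir w) (FL phi psi) (t : R^o, y).
  move=> [_ td]; rewrite -tw.
  apply: (tcoord_dgamma motions w ap aq pp).
  by move: td; rewrite /= cfunK.
have Ys : Y s = 'D_(space_dir w) (FL phi psi) (s : R^o, y).
  by apply: etrans (YE s zd); apply: esym; exact: tcoord_chart_at.
have dY : derive1 (fun t => tcoord psi (Y t)) s =
    'D_(Y s) (field_coord psi X) (cfun psi (gamma s x)).
  rewrite derive1E.
  have nE : \forall t \near s, tcoord psi (Y t) = 'D_(space_dir w) (FL phi psi) (t : R^o, y).
    by apply: filterS nd => t; exact: YE.
  apply: etrans (near_eq_derive _ nE) _.
  have [_ ->] := is_derive_time (dflow_diff motions (space_dir w) ap aq zd).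
  apply: etrans (Ck_on_schwarz _ _ (near_flow_dom motions ap zd)
    (flow_smooth motions ap aq)) _.
  (* the flow equation holds on a neighbourhood, so it may be differentiated in space *)
  have nE2 : \forall z \near (s : R^o, y),
      'D_time_dir (FL phi psi) z = field_coord psi X (FL phi psi z).
    apply: filterS (near_flow_dom motions ap zd) => -[t z] tz.
    exact: (derive_flow_time motions gen ap aq tz).
  apply: etrans (near_eq_derive _ nE2) _.
  have [_ ->] := is_derive_comp (space_dir w) (flow_diff motions ap aq zd)
    (field_diff aq sm Fi).
  by rewrite Ys HE.
rewrite /cov_chart /cov_field -dY christoffel_formC.
apply/rowP => k; rewrite /cov_along -/psi [LHS]mxE [RHS]mxE; congr (_ + _).
rewrite [RHS]mxE bil_sum; apply: eq_bigr => i _; apply: eq_bigr => j _.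
rewrite mxE (gen x s) (field_coord_cfun X pq); congr (_ * _ * _).
  by rewrite tcoord_chart_at.
by rewrite tcoord_chart_at.
Qed.

End KillingFlow.

Theorem theorem2 (R : realType) (n : nat) (M : riemannian_manifold R n)
    (X : vfield M) (gamma : R -> M -> M)
    (X_killing : killing (rmetric M) X)
    (X_unit : unit_vfield (rmetric M) X)
    (gamma_motions : one_parameter_group_of_motions (rmetric M) gamma)
    (X_generates : generates X gamma)
    (x : M) (w : tangent x) :
  let g := rmetric M in
  let c := fun s : R => gamma s x in
  let Y := fun s : R => dmap (gamma s) w : tangent (c s) in
  let DY := cov_along g Y in
  [/\ (forall s, g (c s) (Y s) (Y s) = g x w w),
      (forall s, g (c s) (Y s) (X (c s)) = g x w (X x)),
      (forall s, g (c s) (DY s) (DY s) =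
         g (c s) (curvature g (X (c s)) (Y s) (Y s)) (X (c s))),
      (exists k : R, forall s, g (c s) (DY s) (DY s) = k)
    & g x w w = 1 -> g x w (X x) = 0 ->
        (forall s, g (c s) (DY s) (DY s) = sectional g (X (c s)) (Y s)) /\
        (exists k : R, forall s, sectional g (X (c s)) (Y s) = k)].
Proof.
move=> g c Y DY.
have iso : forall s q (u v : tangent q),
  g (gamma s q) (dmap (gamma s) u) (dmap (gamma s) v) = g q u v.
  by case: gamma_motions.
have YY s : g (c s) (Y s) (Y s) = g x w w by exact: iso.
have YX s : g (c s) (Y s) (X (c s)) = g x w (X x).
  by rewrite /c -(dgamma_field gamma_motions X_generates); exact: iso.
have norm_chart s : let psi := chart_at (c s) in
    g (c s) (DY s) (DY s) = bil (gram g psi (cfun psi (c s)))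
      (cov_chart g X psi (cfun psi (c s)) (Y s))
      (cov_chart g X psi (cfun psi (c s)) (Y s)).
  move=> psi.
  have DE := cov_along_flow X_killing gamma_motions X_generates w s.
  apply: etrans (inner_gram g (DY s) (DY s) (atlas_chart_at (c s)) (cdom_chart_at (c s))) _.
  have tE : tcoord psi (DY s) = cov_chart g X psi (cfun psi (c s)) (Y s).
    exact: etrans (tcoord_chart_at _) DE.
  exact: (bil_congr _ tE tE).
have curv s : g (c s) (DY s) (DY s) =
    g (c s) (curvature g (X (c s)) (Y s) (Y s)) (X (c s)).
  apply: etrans (norm_chart s) _; apply: esym.
  set psi := chart_at (c s).
  have aq : atlas psi := atlas_chart_at (c s).
  have pq : cdom psi (c s) := cdom_chart_at (c s).
  apply: etrans (inner_gram g _ _ aq pq) _.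
  have xE : tcoord psi (X (c s)) = field_coord psi X (cfun psi (c s)).
    exact/esym/field_coord_cfun.
  have rE : tcoord psi (curvature g (X (c s)) (Y s) (Y s)) =
      riem (christoffel_form g psi) (dchristoffel_form g psi) (cfun psi (c s))
        (field_coord psi X (cfun psi (c s))) (Y s) (Y s).
    apply: etrans (tcoord_chart_at _) _.
    apply: etrans (curvature_form g aq (X (c s)) (Y s) (Y s) (cimg_cfun pq)) _.
    exact: (congr1 (fun u => riem (christoffel_form g psi) (dchristoffel_form g psi)
      (cfun psi (c s)) u (Y s) (Y s)) (etrans (esym (tcoord_chart_at (X (c s)))) xE)).
  apply: etrans (bil_congr _ rE xE) _.
  exact: (cov_chart_curvature X_killing (Y s) aq (cimg_cfun pq) X_unit).
pose phi := chart_at x.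
have ap : atlas phi := atlas_chart_at x; have pp : cdom phi x := cdom_chart_at x.
have const s : g (c s) (DY s) (DY s) = bil (gram g phi (cfun phi x))
      (cov_chart g X phi (cfun phi x) w) (cov_chart g X phi (cfun phi x) w).
  apply: etrans (norm_chart s) _.
  set psi := chart_at (c s).
  have aq : atlas psi := atlas_chart_at (c s).
  have pq : cdom psi (c s) := cdom_chart_at (c s).
  have zd : flow_dom gamma phi psi (s : R^o, cfun phi x).
    by split; [exact: cimg_cfun|rewrite /= cfunK].
  have h := flow_cov_norm X_killing gamma_motions X_generates w ap aq zd.
  apply: etrans _ h.
  have -> : flow_coord gamma phi psi (s : R^o, cfun phi x) = cfun psi (c s).
    by rewrite /flow_coord /= cfunK.
  have -> : 'D_(space_dir w) (flow_coord gamma phi psi) (s : R^o, cfun phi x) = Y s.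
    have e := tcoord_dgamma gamma_motions w ap aq pp pq.
    apply: etrans (tcoord_chart_at (Y s)); apply: etrans _ (esym e).
    exact: (congr1 (fun u => 'D_(space_dir u) (flow_coord gamma phi psi)
      (s : R^o, cfun phi x)) (esym (tcoord_chart_at w))).
  by [].
have secE : g x w w = 1 -> g x w (X x) = 0 ->
    forall s, sectional g (X (c s)) (Y s) = g (c s) (DY s) (DY s).
  move=> w1 wX s; rewrite curv /sectional (X_unit (c s)) YY w1.
  by rewrite (inner_sym g (X (c s))) YX wX expr0n subr0 mulr1 divr1.
split => //.
  by exists (bil (gram g phi (cfun phi x))
      (cov_chart g X phi (cfun phi x) w) (cov_chart g X phi (cfun phi x) w)).
move=> w1 wX; split; first by move=> s; rewrite secE.
by eexists => s; rewrite secE //; exact: const.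
Qed.
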